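(* Let $\lambda>0$, $c<\sqrt{\lambda/2}$ and $C>\sqrt{2\lambda}$. Then for all sufficiently large integers $d$, $$c\sqrt d\le \rho_c(d,\lambda)\le C\sqrt d .$$
   Context: Chase-escape with death (CED) with parameters $\lambda>0$ (spreading rate) and $\rho>0$ (death rate) on a graph is the continuous-time Markov process in which every vertex is in one of the states $w$ (white), $r$ (red), $b$ (blue), $\dagger$ (dead), with the following independent transitions: for each edge with one endpoint red and the other white, the white endpoint becomes red at rate $\lambda$; for each edge with one endpoint blue and the other red, the red endpoint becomes blue at rate $1$; each red vertex becomes dead at rate $\rho$. Blue and dead vertices never change state. For an integer $d\ge 2$, the graph considered is the infinite rooted $d$-ary tree $\mathbb T_d$ (every vertex has $d$ children) with one extra vertex $\mathfrak b$ attached to the root. Initially $\mathfrak b$ is blue, the root is red, and all other vertices are white. $P_{\lambda,\rho}$ denotes the law of this process. Let $\mathcal B$ be the set of vertices that are ever blue and $B=\{|\mathcal B|=\infty\}$. Define $\rho_c(d,\lambda)=\inf\{\rho>0: P_{\lambda,\rho}(B)=0\}$. *)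

(* Defs.v *)
From HB Require Import structures.
From mathcomp Require Import all_boot all_order all_algebra.
From mathcomp Require Import all_classical all_reals all_analysis.

Set Implicit Arguments.
Unset Strict Implicit.
Unset Printing Implicit Defensive.

Import Order.TTheory GRing.Theory Num.Theory.
Import numFieldNormedType.Exports.

Local Open Scope classical_set_scope.
Local Open Scope ring_scope.

Definition independent_RVs (R : realType) (disp : measure_display)
    (Omega : measurableType disp) (P : probability Omega R) (I : Type)
    (Y : I -> {RV P >-> R}) : Prop :=
  forall (n : nat) (i : 'I_n -> I) (A : 'I_n -> set R),
    injective i -> (forall k, measurable (A k)) ->
    P (\bigcap_(k in [set: 'I_n]) (Y (i k) @^-1` A k)) =
    (\prod_(k < n) P (Y (i k) @^-1` A k))%E.

(** * Chase-escape with death on a graph [(V, adj)] *)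

Inductive state := White | Red | Blue | Dead.

(** [Spread u v]: [u] turns [v] red; [Chase u v]: [u] turns [v] blue. *)
Inductive transition (V : Type) :=
  | Spread of V & V
  | Chase of V & V
  | Death of V.

Section Dynamics.
Variables (R : realType) (V : Type) (adj : V -> V -> Prop).

Definition rate (lam rho : R) (tau : transition V) : R :=
  match tau with Spread _ _ => lam | Chase _ _ => 1 | Death _ => rho end.

Definition target (tau : transition V) : V :=
  match tau with Spread _ v | Chase _ v | Death v => v end.

Definition outcome (tau : transition V) : state :=
  match tau with Spread _ _ => Red | Chase _ _ => Blue | Death _ => Dead end.

Definition enabled (xi : V -> state) (tau : transition V) : Prop :=
  match tau with
  | Spread u v => [/\ adj u v, xi u = Red & xi v = White]
  | Chase u v => [/\ adj u v, xi u = Blue & xi v = Red]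
  | Death v => xi v = Red
  end.

(** [clock tau] is the waiting time of [tau], counted from the moment [tau]
    becomes enabled; [tau] takes place at time [t] if it has been enabled
    exactly at the times [s] with [t - clock tau <= s < t].  One clock per transition is enough:
    a vertex passes through its states in the order white, red, blue or dead
    and never returns, so that the set of times at which a given transition is
    enabled is an interval. *)
Definition fires (clock : transition V -> R) (x : R -> V -> state)
    (tau : transition V) (t : R) : Prop :=
  0 < clock tau <= t /\
  forall s, 0 <= s < t -> (enabled (x s) tau <-> t - clock tau <= s).

Definition driven_by (clock : transition V -> R) (xi0 : V -> state)
    (x : R -> V -> state) : Prop :=
  [/\ forall v, x 0 v = xi0 v,
      forall tau t, fires clock x tau t -> x t (target tau) = outcome tau
    & forall v s t, 0 <= s <= t ->
        (forall tau u, target tau = v -> s < u <= t -> ~ fires clock x tau u) ->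
        x t v = x s v].

(** [X] is the Markov process with spreading rate [lam] and death rate [rho]
    started from [xi0], realized by independent exponential clocks, one for
    each transition, with parameter the rate of the transition.  The first two
    clauses are the usual regularity of the paths; they make the event that
    infinitely many vertices are ever blue measurable for countable [V]. *)
Definition is_CED (lam rho : R) (xi0 : V -> state) (disp : measure_display)
    (Omega : measurableType disp) (P : probability Omega R)
    (X : R -> Omega -> V -> state) : Prop :=
  [/\ forall t v a, 0 <= t -> measurable [set w | X t w v = a],
      forall w t v, 0 <= t -> \forall s \near t^'+, X s w v = X t w v
    & exists clock : transition V -> {RV P >-> R},
        [/\ independent_RVs clock,
            forall tau A, measurable A ->
              distribution P (clock tau) A =
              exponential_prob (rate lam rho tau) A
          & {ae P, forall w,
              driven_by (fun tau => clock tau w) xi0 (fun t => X t w)}]].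

Definition ever_blue (Omega : Type) (X : R -> Omega -> V -> state)
    (w : Omega) : set V :=
  [set v | exists2 t, 0 <= t & X t w v = Blue].

Definition infinitely_many_blue (Omega : Type) (X : R -> Omega -> V -> state) :
    set Omega :=
  [set w | infinite_set (ever_blue X w)].

End Dynamics.

(** * The rooted [d]-ary tree with an extra vertex attached to the root *)

(** [None] is the extra vertex, [Some [::]] the root, and the children of
    [Some s] are the [Some (i :: s)] for [i : 'I_d]. *)
Definition vertex (d : nat) : Type := option (seq 'I_d).

Definition is_parent (d : nat) (u v : vertex d) : Prop :=
  match u, v with
  | None, Some [::] => True
  | Some s, Some (_ :: s') => s = s'
  | _, _ => False
  end.

Definition tree_adj (d : nat) (u v : vertex d) : Prop :=
  is_parent u v \/ is_parent v u.

Definition tree_init (d : nat) (v : vertex d) : state :=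
  match v with None => Blue | Some [::] => Red | Some _ => White end.

(** The critical death rate; [X rho] is the process with death rate [rho],
    defined on its own probability space [(Omega rho, P rho)].  The infimum is
    taken in the extended reals, so that it is [+oo] on the empty set. *)
Definition rho_c (R : realType) (d : nat) (disp : R -> measure_display)
    (Omega : forall rho : R, measurableType (disp rho))
    (P : forall rho : R, probability (Omega rho) R)
    (X : forall rho : R, R -> Omega rho -> vertex d -> state) : \bar R :=
  ereal_inf [set rho%:E | rho in
    [set rho : R | 0 < rho /\ P rho (infinitely_many_blue (X rho)) = 0%E]].

(* Main.v *)
Require Import Defs.
From HB Require Import structures.
From mathcomp Require Import all_boot all_order all_algebra.
From mathcomp Require Import all_classical all_reals all_analysis.
From mathcomp Require Import measurable_realfun zify ring lra.

Set Implicit Arguments.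
Unset Strict Implicit.
Unset Printing Implicit Defensive.

Import Order.TTheory GRing.Theory Num.Theory.
Import numFieldNormedType.Exports.

Local Open Scope classical_set_scope.
Local Open Scope ring_scope.

(** Write [S], [T] and [D] for the clocks of a vertex: infection by its parent,
    chase by its parent, death. Everything happens along descending paths, since
    almost surely no colour travels upwards: a vertex coloured by a child would
    start an infinite descending ray with summable clocks
    ([no_fast_ray_descent], [no_fast_ray_ae]). Moreover infinitely many vertices
    are blue iff there are blue vertices at every depth
    ([infinitely_many_blueE]).

    Upper bound. If a vertex is ever blue then, for each strict ancestor [u] of it
    and the child [v] of [u] on the way to it, [T u <= D u] and [S v <= D u]:
    infection of [v] and chase of [u] both take place while [u] is red
    ([blue_TD], [blue_parent]). Different levels involve different clocks, and for
    each of them the probability is at most the expectation of [lam * D u ^ 2],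
    that is [2 * lam / rho ^ 2]. So the expected number of candidates at depth [n]
    is at most [(2 * lam * d / rho ^ 2) ^ n], which tends to 0 for
    [rho = C * sqrt d] with [C > sqrt (2 * lam)] ([pr_blue_beyond_le],
    [exists_level_bound]).

    Lower bound. Suppose that a vertex [u] is red, of age [j], when its parent
    turns blue. With the chase clock [a], and if [u] is still alive at age [j + a],
    it turns blue at that age, and each child infected before leads to the same
    situation with a new age ([chased_child]). Only children infected after the
    age [j] are kept; for them the lack of memory makes the offspring law
    independent of [j], apart from the probability for [u] to live up to the age
    [j]. On the scale [1 / rho] of the deaths, which is short when [rho] is of
    order [sqrt d], the mean number of offspring is close to
    [d * lam * \int_0^oo exp (- rho * t) \int_0^t exp (- rho * i) di dt], which is
    [d * lam / (2 * rho ^ 2)]; it exceeds 1 when [rho < c * sqrt d] with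
    [c < sqrt (lam / 2)]. As for a supercritical branching process, a lower bound
    on the survival probability is then preserved from one generation to the next
    ([survival_lb], [survival_step]).

    Discretization. Both computations use nothing but the product rule for
    events that prescribe cells of a grid for finitely many clocks. For the lower
    bound, ages are then known up to [n] meshes after [n] generations
    ([survives_blue]); the mesh is chosen after [n], while the bound on the
    survival probability does not depend on [n] ([survival_bounded_below]). The
    labels of the cells along a tree form a finite weighted set of trees
    ([ltree]), on which the recursion over generations is elementary. *)

(** * A single path of the dynamics on a graph *)

Section Paths.
Variables (R : realType) (V : Type) (adj : V -> V -> Prop).
Variables (clock : transition V -> R) (xi0 : V -> state).
Variable x : R -> V -> state.
Hypothesis drv : driven_by adj clock xi0 x.
Hypothesis rc : forall t v, 0 <= t -> \forall s \near t^'+, x s v = x t v.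

(** Both a chase and a death need a red target: this is what forces the order
    white, red, blue or dead. *)
Definition source (tau : transition V) : state :=
  if tau is Spread _ _ then White else Red.

Lemma enabled_source tau xi : enabled adj xi tau -> xi (target tau) = source tau.
Proof. by case: tau => [u v|u v|v] /=; [case|case|]. Qed.

Lemma fires_source tau e u : fires adj clock x tau e ->
  0 <= u -> e - clock tau <= u < e -> x u (target tau) = source tau.
Proof.
move=> [_ H] u0 /andP[eu ue]; apply: enabled_source.
by apply/H => //; rewrite u0 ue.
Qed.

Lemma fires_source_before tau s e : fires adj clock x tau e -> 0 <= s < e ->
  exists2 u, s <= u < e & x u (target tau) = source tau.
Proof.
move=> fe /andP[s0 se]; have [/andP[c0 ce] _] := fe.
exists (Num.max s (e - clock tau)).
  by rewrite le_max lexx /= gt_max se /= gtrBl.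
apply: (fires_source fe); first by rewrite le_max s0.
by rewrite le_max lexx orbT /= gt_max se /= gtrBl.
Qed.

(** The infimum [e] of the later times at which the state of [v] differs is
    attained, by right-continuity. Before [e] no transition with target [v] can
    fire: it would need its source, the current state, just before, and would
    leave its outcome, another state. So the change at [e] has to come from a
    transition that fires exactly then. *)
Lemma exit_time v s t : 0 <= s <= t -> x t v <> x s v ->
  exists e tau, [/\ s < e <= t,
    forall u, s <= u < e -> x u v = x s v, fires adj clock x tau e,
    target tau = v & source tau = x s v].
Proof.
move=> /andP[s0 st] ts.
pose A := [set u | s <= u /\ x u v <> x s v].
have A0 : A !=set0 by exists t; split.
have lA : has_lbound A by exists s => u [].
have hA : has_inf A by split.
pose e := inf A.
have se : s <= e by apply: lb_le_inf => // u [].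
have e0 : 0 <= e by apply: le_trans se.
have et : e <= t by apply: ge_inf => //; split.
have lo u : s <= u < e -> x u v = x s v.
  move=> /andP[su ue]; apply: contrapT => xu.
  have : e <= u by apply: ge_inf => //; split.
  by rewrite leNgt ue.
have xe : x e v <> x s v.
  move=> xes; have := rc v e0; rewrite near_withinE => -[d /= d0 hd].
  have [u Au ue] := inf_adherent d0 hA.
  have eu : e <= u by apply: ge_inf.
  case: Au => su; apply.
  have [->//|ne] := eqVneq u e.
  rewrite -xes; apply: hd; last by rewrite lt_neqAle eq_sym ne.
  by rewrite /ball/= distrC ger0_norm ?subr_ge0// ltrBlDl.
have lse : s < e.
  by rewrite lt_neqAle se andbT; apply/eqP => E; apply: xe; rewrite -E.
have nofire tau u : target tau = v -> s < u < e -> ~ fires adj clock x tau u.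
  move=> tv /andP[su ue] fu.
  have [w /andP[sw wu] xw] := fires_source_before fu (introT andP (conj s0 su)).
  have [_ out _] := drv.
  have xu := out _ _ fu; rewrite tv in xu xw.
  move: xu xw; rewrite lo; last by rewrite (ltW su).
  rewrite lo; last by rewrite sw (lt_trans wu).
  by move=> ->; case: (tau).
have [tau [tv fe]] : exists tau, target tau = v /\ fires adj clock x tau e.
  apply: contrapT => nf; apply: xe.
  have [_ _ cst] := drv; apply: cst; first by rewrite s0 se.
  move=> tau u tv /andP[su ue] fu.
  move: ue; rewrite le_eqVlt => /orP[/eqP E|ue].
    by apply: nf; exists tau; rewrite -E.
  by apply: (nofire tau u) => //; rewrite su.
exists e, tau; split => //; first by rewrite lse.
have [w /andP[sw we] xw] := fires_source_before fe (introT andP (conj s0 lse)).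
by rewrite -xw tv lo// sw.
Qed.

(** No transition has a blue or a dead source, so [exit_time] has nothing to
    offer. *)
Lemma final_forever v s t a : 0 <= s <= t -> x s v = a -> a = Blue \/ a = Dead ->
  x t v = a.
Proof.
move=> st xs aa; apply: contrapT => xt.
have [||e [tau [_ _ _ _ src]]] := @exit_time v s t => //; first by rewrite xs.
by move: src; rewrite xs; case: aa => ->; case: tau.
Qed.

Lemma fires_outcome tau e : fires adj clock x tau e -> x e (target tau) = outcome tau.
Proof. by have [_ out _] := drv; apply: out. Qed.

Lemma red_not_white v s t : 0 <= s <= t -> x s v = Red -> x t v <> White.
Proof.
move=> st xs xt.
have [||e [tau [/andP[se et] _ fe tv src]]] := @exit_time v s t => //.
  by rewrite xs xt.
have /andP[s0 _] := st.
have e0 : 0 <= e <= t by rewrite et andbT (le_trans s0 (ltW se)).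
have := fires_outcome fe; rewrite tv; move: src; rewrite xs.
case: tau {tv fe} => [//|? ?|?] _ /= xe.
  by have := final_forever e0 xe (or_introl erefl); rewrite xt.
by have := final_forever e0 xe (or_intror erefl); rewrite xt.
Qed.

Lemma white_exit v t : 0 <= t -> x 0 v = White -> x t v <> White ->
  exists r u, [/\ 0 < r <= t, forall s, 0 <= s < r -> x s v = White,
    fires adj clock x (Spread u v) r & x r v = Red].
Proof.
move=> t0 xi xt.
have [||r [tau [/andP[r0 rt] lo fr tv src]]] := @exit_time v 0 t.
- by rewrite lexx.
- by rewrite xi.
case: tau tv src fr => [u w|u w|w] /= ->; rewrite ?xi// => _ fr.
exists r, u; split => //; first by rewrite r0.
- by move=> s /lo; rewrite xi.
- exact: (fires_outcome fr).
Qed.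

(** In the first alternative the vertex dies, in the second one it is chased.
    Either way its red life cannot exceed its death clock, since death fires as
    soon as the vertex has been red for that long. *)
Lemma red_exit v r t : 0 <= r <= t -> x r v = Red -> x t v <> Red ->
  (forall s, 0 <= s < r -> x s v = White) -> 0 < clock (Death v) ->
  exists b, [/\ r < b <= t, forall s, r <= s < b -> x s v = Red,
    b <= r + clock (Death v) &
    (x b v = Dead /\ b = r + clock (Death v)) \/
    exists u, fires adj clock x (Chase u v) b /\ clock (Chase u v) <= b - r].
Proof.
move=> /andP[r0 rt] xr xt wh D0.
have [||b [tau [/andP[rb bt] lo fb tv src]]] := @exit_time v r t.
- by rewrite r0.
- by rewrite xr.
rewrite xr in lo.
have b0 : 0 <= b by rewrite (le_trans r0)// ltW.
exists b.
have bD : b <= r + clock (Death v).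
  rewrite leNgt; apply/negP => Db.
  have fD : fires adj clock x (Death v) (r + clock (Death v)).
    split; first by rewrite D0 lerDr.
    move=> s /andP[s0 sD] /=; rewrite addrK; split => [xs|rs].
      by rewrite leNgt; apply/negP => sr; move: xs; rewrite wh ?s0.
    by apply: lo; rewrite rs (lt_trans sD).
  have := fires_outcome fD; rewrite /= lo ?Db ?andbT ?lerDl ?(ltW D0)//.
have red_ge s : 0 <= s < b -> x s v = Red -> r <= s.
  move=> /andP[s0 sb] xs; rewrite leNgt; apply/negP => sr.
  by move: xs; rewrite wh ?s0.
split => //; first by rewrite rb.
case: tau tv src fb => [u w|u w|w] /= ->; rewrite ?xr// => _ fb; [right|left].
  exists u; split => //.
  have [/andP[c0 cb] _] := fb.
  have rc' : r <= b - clock (Chase u v).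
    apply: red_ge; first by rewrite subr_ge0 cb gtrBl.
    by apply: (fires_source fb); rewrite ?subr_ge0// lexx gtrBl.
  lra.
split; first exact: (fires_outcome fb).
have [/andP[c0 cb] _] := fb.
have rc' : r <= b - clock (Death v).
  apply: red_ge; first by rewrite subr_ge0 cb gtrBl.
  by apply: (fires_source fb); rewrite ?subr_ge0// lexx gtrBl.
by apply/eqP; rewrite eq_le bD -lerBrDr rc'.
Qed.

End Paths.

(** * A single path of the dynamics on the tree *)

Definition par (d : nat) (s : seq 'I_d) : vertex d :=
  if s is _ :: q then Some q else None.

Lemma tree_adjP d (u : vertex d) (s : seq 'I_d) : tree_adj u (Some s) ->
  u = par s \/ exists i, u = Some (i :: s).
Proof.
case: u => [q|]; case: s => [|i s] [] //=.
- by case: q => // j q <-; right; exists j.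
- by move=> ->; left.
- by case: q => // j q <-; right; exists j.
- by left.
Qed.

Lemma par_adj d (s : seq 'I_d) : tree_adj (par s) (Some s).
Proof. by left; case: s. Qed.

(** [c s] is the clock of an edge above the vertex [s]. The condition excludes a
    descending ray along which the clocks are summable: along such a ray all
    clocks but finitely many would be smaller than [eps]. *)
Definition no_fast_ray (R : realType) d (c : seq 'I_d -> R) : Prop :=
  exists2 eps, 0 < eps & forall s, exists n, forall p, size p = n ->
    exists2 i, (i < n)%N & eps <= c (drop i p ++ s).

(** On an infinite tree the dynamics alone does not exclude that a colour comes
    in from infinity: a vertex could be coloured by a child, which was itself
    coloured earlier by a child, and so on. An event of this kind is [bad s t].
    Going down, time decreases by the clocks. A clock at least [eps] brings back
    to an earlier time window of length [eps], where the claim is known by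
    induction, so all the clocks met are below [eps]; this contradicts
    [no_fast_ray]. *)
Lemma no_fast_ray_descent (R : realType) d (c : seq 'I_d -> R)
    (bad : seq 'I_d -> R -> Prop) :
  no_fast_ray c ->
  (forall s t, bad s t -> 0 <= t) ->
  (forall s t, bad s t -> exists i t', bad (i :: s) t' /\ t' + c (i :: s) <= t) ->
  (forall s, 0 <= c s) ->
  forall s t, ~ bad s t.
Proof.
move=> [eps eps0 fast] bad0 step c0.
suff H N : forall s t, t < N%:R * eps -> ~ bad s t.
  move=> s t bst; pose N := (Num.truncn (t / eps)).+1.
  apply: (H N) bst; rewrite -ltr_pdivrMr//.
  exact: truncnS_gt.
elim: N => [|N IH] s t tN bst; first by have := bad0 _ _ bst; lra.
have [n hn] := fast s.
have [p [sp _ cp]] : exists p : seq 'I_d, [/\ size p = n,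
    exists2 t', bad (p ++ s) t' & t' <= t &
    forall i, (i < n)%N -> c (drop i p ++ s) < eps].
  elim: {hn} n => [|n [p [sp [t' bt' tt'] cp]]].
    by exists [::]; split => //; exists t.
  have [i [t'' [bt'' ct]]] := step _ _ bt'.
  have ce : c (i :: p ++ s) < eps.
    rewrite ltNge; apply/negP => ce; apply: (IH _ t'' _ bt'').
    rewrite -natr1 in tN; lra.
  exists (i :: p); split => /=; first by rewrite sp.
    by exists t'' => //; have := c0 (i :: p ++ s); lra.
  by case.
have [i iN] := hn p sp; by rewrite leNgt cp.
Qed.

Section Tree.
Variables (R : realType) (d : nat) (clock : transition (vertex d) -> R).
Variable x : R -> vertex d -> state.
Hypothesis drv : driven_by (@tree_adj d) clock (@tree_init d) x.
Hypothesis rc : forall t v, 0 <= t -> \forall s \near t^'+, x s v = x t v.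
Hypothesis clock_gt0 : forall tau, 0 < clock tau.
Hypothesis slow_spread : no_fast_ray (fun s => clock (Spread (Some s) (par s))).
Hypothesis slow_chase : no_fast_ray (fun s => clock (Chase (Some s) (par s))).

Notation fires := (fires (@tree_adj d) clock x).
Notation sT s := (clock (Chase (par s) (Some s))).
Notation sS s := (clock (Spread (par s) (Some s))).
Notation sD s := (clock (Death (Some s))).

Lemma init_white i s : x 0 (Some (i :: s)) = White.
Proof. by have [-> _ _] := drv. Qed.

Lemma fires_start tau t : fires tau t ->
  0 <= t - clock tau /\ enabled (@tree_adj d) (x (t - clock tau)) tau.
Proof.
move=> [/andP[c0 ct] H]; rewrite subr_ge0; split => //.
by apply/H; rewrite ?lexx// subr_ge0 ct gtrBl.
Qed.

Lemma fires_gt0 tau t : fires tau t -> 0 < t.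
Proof. by move=> [/andP[c0 /(lt_le_trans c0)]]. Qed.

(** If a child infects [s] at time [t] then the child turned red earlier. It was
    not infected by [s], which was still white, hence by one of its own
    children: this is the descent excluded by [no_fast_ray_descent]. *)
Lemma spread_from_parent u s t : fires (Spread u (Some s)) t -> u = par s.
Proof.
move=> fu; have [_ /= [/tree_adjP ad _ _]] := fires_start fu.
case: ad => // -[i E]; exfalso; rewrite {u}E in fu.
pose bad s t := exists i, fires (Spread (Some (i :: s)) (Some s)) t.
apply: (no_fast_ray_descent (bad := bad) slow_spread _ _ _ (s := s) (t := t));
  last by exists i.
- by move=> {fu}s {}t [{}i /fires_gt0/ltW].
- move=> {fu}s {}t [{}i fu].
  have [u0 /= [_ xi xs]] := fires_start fu.
  have [|r [u [/andP[r0 rt] lo fr xr]]] := white_exit drv rc u0 (init_white i s).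
    by rewrite xi.
  exists i, r; split; last by rewrite -lerBrDr.
  have [w0 /= [/tree_adjP ad xu _]] := fires_start fr.
  case: ad => [E|[j E]]; last by exists j; rewrite -E.
  exfalso; rewrite E /= in xu fr w0; apply: (red_not_white drv rc _ xu xs).
  by rewrite w0 (le_trans _ rt)// gerBl ltW.
- by move=> s0; exact: ltW.
Qed.

(** Same descent as for [spread_from_parent], with blue instead of red: a child
    that chases [s] was not chased by [s], which was still red. *)
Lemma chase_from_parent u s t : fires (Chase u (Some s)) t -> u = par s.
Proof.
move=> fu; have [_ /= [/tree_adjP ad _ _]] := fires_start fu.
case: ad => // -[i E]; exfalso; rewrite {u}E in fu.
pose bad s t := exists i, fires (Chase (Some (i :: s)) (Some s)) t.
apply: (no_fast_ray_descent (bad := bad) slow_chase _ _ _ (s := s) (t := t));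
  last by exists i.
- by move=> {fu}s {}t [{}i /fires_gt0/ltW].
- move=> {fu}s {}t [{}i fu].
  have [u0 /= [_ xi xs]] := fires_start fu.
  have [|r [u [/andP[r0 rt] lo fr xr]]] := white_exit drv rc u0 (init_white i s).
    by rewrite xi.
  have [||b [/andP[rb bt] _ _ bb]] :=
    red_exit (t := t - clock (Chase (Some (i :: s)) (Some s))) drv rc _ xr _ lo (clock_gt0 _).
  + by rewrite (ltW r0) rt.
  + by rewrite xi.
  have b0 : 0 < b by apply: lt_trans rb.
  case: bb => [[xb _]|[v [fb _]]].
    by rewrite (final_forever drv rc _ xb (or_intror erefl)) ?(ltW b0)// in xi.
  exists i, b; split; last by rewrite -lerBrDr.
  have [w0 /= [/tree_adjP ad xv _]] := fires_start fb.
  case: ad => [E|[j E]]; last by exists j; rewrite -E.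
  exfalso; rewrite E /= in xv fb w0.
  have := final_forever drv rc _ xv (or_introl erefl).
  move/(_ (t - clock (Chase (Some (i :: s)) (Some s)))); rewrite xs => X.
  suff: Red = Blue by [].
  by apply: X; rewrite w0 (le_trans _ bt)// gerBl ltW.
- by move=> s0; exact: ltW.
Qed.

(** The first change of a vertex that is ever blue is an infection, except at the
    root, and the second one a chase, because death would be final. *)
Lemma blue_history s t : 0 <= t -> x t (Some s) = Blue ->
  exists r b, [/\ 0 <= r, r < b <= t,
    (forall u, 0 <= u < r -> x u (Some s) = White)
      /\ (forall u, r <= u < b -> x u (Some s) = Red),
    b <= r + sD s & [/\ sT s <= b - r, fires (Chase (par s) (Some s)) b
      & s = [::] \/ fires (Spread (par s) (Some s)) r]].
Proof.
move=> t0 xt.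
have [r [r0 rt lo xr fr]] : exists r, [/\ 0 <= r, r <= t,
    forall u, 0 <= u < r -> x u (Some s) = White, x r (Some s) = Red &
    s = [::] \/ fires (Spread (par s) (Some s)) r].
  case: s xt => [|i s] xt.
    exists 0; split => //; [|by have [-> _ _] := drv|by left].
    by move=> u; case: ltP => //; rewrite ?andbF// => _ /andP[/le_lt_trans h /h]; rewrite ltxx.
  have [|r [u [/andP[r0 rt] lo fr xr]]] := white_exit drv rc t0 (init_white i s).
    by rewrite xt.
  exists r; split => //; first exact: ltW.
  by right; rewrite -(spread_from_parent fr).
have [||b [/andP[rb bt] re bD bb]] := red_exit (t := t) drv rc _ xr _ lo (clock_gt0 _).
- by rewrite r0 rt.
- by rewrite xt.
exists r, b; have b0 : 0 <= b by rewrite (le_trans r0)// ltW.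
case: bb => [[xb _]|[v [fb cb]]].
  by move: xt; rewrite (final_forever drv rc _ xb (or_intror erefl)) ?b0.
have E := chase_from_parent fb; rewrite E in fb cb.
by split => //; rewrite rb.
Qed.

Definition eventually_blue s := exists2 t, 0 <= t & x t (Some s) = Blue.

Lemma blue_TD s : eventually_blue s -> sT s <= sD s.
Proof.
by move=> [t t0 /(blue_history t0)[r [b [r0 _ _ bD [Tb _ _]]]]]; lra.
Qed.

(** The child turned red by infection from its parent, which is red for a time at
    most its death clock; the infection took place within that time. *)
Lemma blue_parent i s : eventually_blue (i :: s) ->
  eventually_blue s /\ sS (i :: s) <= sD s.
Proof.
move=> [t t0 /(blue_history t0)[r [b [r0 rbt [lo re] bD [Tb fb [//|fr]]]]]].
have [b0 /= [_ xb _]] := fires_start fb.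
split; first by exists (b - clock (Chase (Some s) (Some (i :: s)))).
have [r'0 /= [_ xr' _]] := fires_start fr.
have [r1 [b1 [r10 /andP[rb1 b1t] [lo1 re1] bD1 [_ fb1 _]]]] := blue_history b0 xb.
have h1 : r1 <= r - clock (Spread (Some s) (Some (i :: s))).
  by rewrite leNgt; apply/negP => h; move: xr'; rewrite lo1// r'0.
suff h2 : r <= b1 by rewrite /=; lra.
rewrite leNgt; apply/negP => h.
have b10 : 0 <= b1 by apply: le_trans (ltW rb1).
pose w := Num.max b1 (r - clock (Spread (Some s) (Some (i :: s)))).
have wr : w < r by rewrite gt_max h gtrBl clock_gt0.
have b1w : b1 <= w by rewrite le_max lexx.
have w0 : 0 <= w by apply: le_trans b1w.
have : enabled (@tree_adj d) (x w) (Spread (Some s) (Some (i :: s))).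
  by have [_ H] := fr; apply/H; rewrite ?w0// /w le_max lexx orbT.
move=> /= [_ xw _].
have := final_forever drv rc _ (fires_outcome drv fb1) (or_introl erefl).
by move/(_ w); rewrite b10 b1w /= xw => /(_ isT).
Qed.

Lemma eventually_blue_drop m s : eventually_blue s -> eventually_blue (drop m s).
Proof.
by elim: s m => [|i s IH] [|m] //= /blue_parent[bs _]; exact: IH.
Qed.

(** The renewal situation: [s] turned red at [r], its parent turned blue at
    [beta], and [beta - r] is the age of [s] at that moment. *)
Definition chased s r beta :=
  [/\ 0 <= r <= beta, forall u, 0 <= u -> (x u (par s) = Blue <-> beta <= u),
    forall u, 0 <= u < r -> x u (Some s) = White & x r (Some s) = Red].

Lemma chased_root : chased [::] 0 0.
Proof.
have [x0 _ _] := drv.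
split; rewrite ?lexx// ?x0// => u.
  move=> u0; split => // _.
  apply: (final_forever drv rc (s := 0)); [by rewrite lexx|by rewrite x0|by left].
by move=> /andP[u0 /(le_lt_trans u0)]; rewrite ltxx.
Qed.

Section Chased.
Variables (s : seq 'I_d) (r beta : R).
Hypotheses (ch : chased s r beta) (alive : beta + sT s < r + sD s).

Lemma chased_red u : r <= u < beta + sT s -> x u (Some s) = Red.
Proof.
have [/andP[r0 rb] pb lo xr] := ch => /andP[ru ub].
apply: contrapT => xu.
have [||b [/andP[rb' bu] re bD bb]] := red_exit (t := u) drv rc _ xr _ lo (clock_gt0 _).
- by rewrite r0.
- by [].
case: bb => [[_ E]|[v [fb cb]]].
  by have := lt_trans (le_lt_trans bu ub) alive; rewrite -E ltxx.
have Ev := chase_from_parent fb; rewrite {v}Ev in fb cb.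
have [b0 /= [_ xb _]] := fires_start fb.
have := (pb _ b0).1 xb; rewrite lerBrDr => bb.
by have := lt_le_trans (le_lt_trans bu ub) bb; rewrite ltxx.
Qed.

Lemma chased_blue u : 0 <= u -> (x u (Some s) = Blue <-> beta + sT s <= u).
Proof.
have [/andP[r0 rb] pb lo xr] := ch => u0.
have T0 := clock_gt0 (Chase (par s) (Some s)).
have fb : fires (Chase (par s) (Some s)) (beta + sT s).
  split; first by rewrite T0 lerDr (le_trans r0).
  move=> w /andP[w0 wb] /=; rewrite addrK; split => [[_ xp _]|bw].
    exact/(pb _ w0).
  split; [exact: par_adj|exact/pb|].
  by apply: chased_red; rewrite wb (le_trans rb).
have xb := fires_outcome drv fb.
split => [xu|bu].
  rewrite leNgt; apply/negP => ub.
  have [ur|ru] := ltP u r; first by rewrite lo ?u0 in xu.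
  by rewrite chased_red ?ru in xu.
apply: (final_forever drv rc _ xb (or_introl erefl)).
by rewrite bu andbT; lra.
Qed.

(** A child infected before [s] turns blue is in turn in the renewal situation,
    with new age [beta + sT s - (r + sS (i :: s))]. *)
Lemma chased_child i : sS (i :: s) < beta + sT s - r ->
  chased (i :: s) (r + sS (i :: s)) (beta + sT s).
Proof.
have [/andP[r0 rb] pb lo xr] := ch => Sl.
have S0 := clock_gt0 (Spread (par (i :: s)) (Some (i :: s))).
have T0 := clock_gt0 (Chase (par s) (Some s)).
have rS0 : 0 <= r + sS (i :: s) by lra.
have red_ge w : 0 <= w -> x w (Some s) = Red -> r <= w.
  by move=> w0 xw; rewrite leNgt; apply/negP => wr; rewrite lo ?w0 in xw.
have wh u : 0 <= u < r + sS (i :: s) -> x u (Some (i :: s)) = White.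
  move=> /andP[u0 ur]; apply: contrapT => xu.
  have [e [v [/andP[e0 eu] _ fe _]]] := white_exit drv rc u0 (init_white i s) xu.
  have Ev := spread_from_parent fe; rewrite {v}Ev in fe.
  have [w0 /= [_ xw _]] := fires_start fe.
  by have /= := red_ge _ w0 xw; rewrite /= in ur; lra.
split => //.
- by rewrite rS0 /=; rewrite /= in Sl; lra.
- by move=> u u0; exact: chased_blue.
have fr : fires (Spread (par (i :: s)) (Some (i :: s))) (r + sS (i :: s)).
  split; first by rewrite S0 lerDr.
  move=> w /andP[w0 wr]; rewrite addrK /=; split => [[_ xw _]|rw].
    exact: red_ge.
  split; [exact: (par_adj (i :: s))| |by apply: wh; rewrite w0].
  by apply: chased_red; rewrite rw /=; rewrite /= in wr Sl; lra.
exact: (fires_outcome drv fr).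
Qed.

End Chased.

End Tree.

(** * Probabilities of events in independent exponential clocks *)

Lemma exponential_prob_itvoy (R : realType) (r y : R) : 0 < r -> 0 <= y ->
  exponential_prob r `]y, +oo[ = (expR (- (r * y)))%:E.
Proof.
move=> r0 y0.
have sub : ([set` `[y, +oo[] : set R) `<=` [set` `[0, +oo[].
  by move=> z /=; rewrite !in_itv/= !andbT; exact: le_trans.
rewrite /exponential_prob integral_itv_obnd_cbnd; last first.
  by apply/measurable_EFinP/measurable_funTS; exact: measurable_exponential_pdf.
have cE : continuous (fun z : R^o => expR (- r * z)).
  move=> z; apply: continuous_comp; last exact: continuous_expR.
  by apply: continuousM => //; apply: (@continuousN _ R^o); exact: cst_continuous.
rewrite (@ge0_continuous_FTC2y _ _ (fun x => - expR (- r * x)) _ 0)//.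
- by rewrite sub0e EFinN oppeK mulNr.
- by move=> x _; apply: exponential_pdf_ge0; exact: ltW.
- apply: (@continuous_subspaceW R^o _ _ [set` `[0, +oo[%R]) => //.
  exact: within_continuous_exponential_pdf.
- rewrite -oppr0; apply: cvgN.
  rewrite (_ : (fun x => expR (- r * x)) =
               (fun z => expR (- z)) \o (fun z => r * z)); last first.
    by apply: eq_fun => x; rewrite mulNr.
  apply: (@cvg_comp _ _ _ _ _ _ (pinfty_nbhs R)); last exact: cvgr_expR.
  exact: gt0_cvgMry.
- by apply/cvg_at_right_filter; apply: cvgN; exact: cE.
- move=> z; rewrite in_itv/= andbT => yz.
  by apply: derive1_exponential_pdf; rewrite in_itv/= andbT (le_lt_trans y0).
Qed.

Section Pr.
Context (R : realType) (disp : measure_display) (Omega : measurableType disp).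
Variable P : probability Omega R.

(** Probabilities as real numbers, to stay clear of extended arithmetic. *)
Definition pr (A : set Omega) : R := fine (P A).

Lemma prE A : measurable A -> P A = (pr A)%:E.
Proof. by move=> mA; rewrite /pr fineK// fin_num_measure. Qed.

Lemma pr_ge0 A : 0 <= pr A.
Proof. exact/fine_ge0/measure_ge0. Qed.

Lemma pr_mono A B : measurable A -> measurable B -> A `<=` B -> pr A <= pr B.
Proof.
move=> mA mB AB; rewrite -lee_fin -!prE//.
by apply: le_measure; rewrite ?inE.
Qed.

Lemma prT : pr setT = 1.
Proof. by rewrite /pr probability_setT. Qed.

Lemma pr0 : pr set0 = 0.
Proof. by rewrite /pr measure0. Qed.

Lemma pr_setU A B : measurable A -> measurable B -> A `&` B = set0 ->
  pr (A `|` B) = pr A + pr B.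
Proof.
move=> mA mB AB; apply: EFin_inj; rewrite EFinD -!prE//.
  exact: measureU.
exact: measurableU.
Qed.

Lemma pr_setU_le A B : measurable A -> measurable B ->
  pr (A `|` B) <= pr A + pr B.
Proof.
move=> mA mB; rewrite -lee_fin EFinD -!prE//; last exact: measurableU.
exact: measureU2.
Qed.

Lemma pr_bigsetU_le (I : Type) (r : seq I) (Q : pred I) (F : I -> set Omega) :
  (forall i, measurable (F i)) ->
  pr (\big[setU/set0]_(i <- r | Q i) F i) <= \sum_(i <- r | Q i) pr (F i).
Proof.
move=> mF; elim: r => [|i r IH]; first by rewrite !big_nil pr0.
rewrite !big_cons; case: ifP => // _.
apply: le_trans (pr_setU_le _ _) _ => //; first exact: bigsetU_measurable.
by rewrite lerD2l.
Qed.

Lemma pr_bigsetU (I : finType) (Q : pred I) (F : I -> set Omega) :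
  (forall i, measurable (F i)) -> (forall i j, i != j -> F i `&` F j = set0) ->
  pr (\big[setU/set0]_(i | Q i) F i) = \sum_(i | Q i) pr (F i).
Proof.
move=> mF tF.
elim: (index_enum I) (index_enum_uniq I) => [|i r IH] /=.
  by rewrite !big_nil pr0.
move=> /andP[ir /IH{}IH]; rewrite !big_cons; case: ifP => // _.
rewrite pr_setU//; [by rewrite IH|exact: bigsetU_measurable|].
rewrite setIC -subset0 => w [].
rewrite big_seq_cond => + Fi; elim/big_ind: _ => //.
- by move=> A B hA hB [/hA|/hB].
- move=> j /andP[jr _] Fj; rewrite -(tF i j); first by split.
  by apply: contraNneq ir => ->.
Qed.

(** The product rule for a duplicate-free list of indices [k], each paired with a
    label [a] that selects the measurable set [A k a]; the labels will be the
    cells of a grid. *)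
Lemma pr_indep (I : Type) (Y : I -> {RV P >-> R}) (K : eqType) (L : Type)
    (f : K -> I) (l : seq (K * L)) (A : K -> L -> set R) :
  independent_RVs Y -> injective f -> uniq (unzip1 l) ->
  (forall k a, measurable (A k a)) ->
  pr (\big[setI/setT]_(p <- l) (Y (f p.1) @^-1` A p.1 p.2)) =
  \prod_(p <- l) pr (Y (f p.1) @^-1` A p.1 p.2).
Proof.
move=> ind finj ul mA.
have mYA p : measurable (Y (f p.1) @^-1` A p.1 p.2).
  by rewrite -[X in measurable X]setTI; exact: measurable_funPT.
pose t := in_tuple l.
have := ind (size l) (fun i => f (tnth t i).1)
  (fun i => A (tnth t i).1 (tnth t i).2).
rewrite /t /= => H; apply: EFin_inj; rewrite -prE; last exact: bigsetI_measurable.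
rewrite big_tnth [X in _ = X%:E]big_tnth -prodEFin.
rewrite (_ : \big[_/_]_(i < _) _ = \bigcap_(k in [set: 'I_(size l)])
  (Y (f (tnth t k).1) @^-1` A (tnth t k).1 (tnth t k).2)); last first.
  rewrite -bigcap_seq; congr bigcap.
  by apply/seteqP; split => i //= _; rewrite mem_index_enum.
rewrite H; first by apply: eq_bigr => i _; rewrite -prE.
- move=> i j /finj E; apply/val_inj/eqP.
  rewrite -(nth_uniq (tnth t i).1 _ _ ul) ?size_map ?ltn_ord//.
  have nE k : nth (tnth t i).1 (unzip1 l) k = (nth (tnth t i) l k).1 \/ (size l <= k)%N.
    by case: (ltnP k (size l)) => kl; [left; rewrite (nth_map (tnth t i))|right].
  case: (nE i) => [->|]; last by rewrite leqNgt ltn_ord.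
  case: (nE j) => [->|]; last by rewrite leqNgt ltn_ord.
  by rewrite -!(tnth_nth _ t) E.
- by move=> k; exact: mA.
Qed.

Section Exponential.
Variables (Y : {RV P >-> R}) (r : R).
Hypothesis r_gt0 : 0 < r.
Hypothesis law : forall A, measurable A -> distribution P Y A = exponential_prob r A.

Lemma measurable_RV (A : set R) : measurable A -> measurable (Y @^-1` A).
Proof. by move=> mA; rewrite -[X in measurable X]setTI; exact: measurable_funPT. Qed.

Lemma pr_gt y : 0 <= y -> pr (Y @^-1` `]y, +oo[) = expR (- (r * y)).
Proof.
move=> y0; apply: EFin_inj; rewrite -prE; last exact: measurable_RV.
rewrite -exponential_prob_itvoy//; exact: law.
Qed.

Lemma pr_le y : 0 <= y -> pr (Y @^-1` `]-oo, y]) = 1 - expR (- (r * y)).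
Proof.
move=> y0; rewrite -pr_gt//; apply/eqP; rewrite -subr_eq opprK -prT; apply/eqP.
rewrite -pr_setU; try exact: measurable_RV.
  by congr pr; apply/seteqP; split => // w _ /=; rewrite !in_itv/= andbT; case: leP; auto.
by rewrite -subset0 => w [/=]; rewrite !in_itv/= andbT leNgt => /negP.
Qed.

Lemma pr_itvoc a b : 0 <= a <= b ->
  pr (Y @^-1` `]a, b]) = expR (- (r * a)) - expR (- (r * b)).
Proof.
move=> /andP[a0 ab]; have b0 := le_trans a0 ab.
rewrite -!pr_gt//; apply/eqP; rewrite -subr_eq opprK; apply/eqP.
rewrite -pr_setU; try exact: measurable_RV.
  congr pr; apply/seteqP; split => w /=; rewrite !in_itv/= ?andbT.
    by move=> [/andP[]|/(le_lt_trans ab)].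
  by move=> ->; case: leP; auto.
by rewrite -subset0 => w [/=]; rewrite !in_itv/= andbT => /andP[_]; rewrite leNgt => /negP.
Qed.

End Exponential.
End Pr.

(** * Discretized exponential variables *)

Section Grid.
Variables (R : realType) (delta : R) (M : nat).

(** Left-open cells give the strict lower bounds on clocks that the dynamics
    needs. The cell of index [M] is unbounded. *)
Definition cell (k : nat) : set R :=
  if (k < M)%N then [set` `]k%:R * delta, k.+1%:R * delta]]
  else [set` `]M%:R * delta, +oo[].

(** The probability of the cell [k] under the exponential law of rate [r]; with
    [x = expR (- (r * delta))] it is [x ^+ k - x ^+ k.+1], a truncated geometric
    law. *)
Definition mass (r : R) (k : 'I_M.+1) : R :=
  expR (- (r * delta)) ^+ k
    - (if (k < M)%N then expR (- (r * delta)) ^+ k.+1 else 0).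

Lemma measurable_cell k : measurable (cell k).
Proof. by rewrite /cell; case: ifP. Qed.

Hypothesis delta_gt0 : 0 < delta.

Lemma cell_gt (k : 'I_M.+1) y : cell k y -> k%:R * delta < y.
Proof.
rewrite /cell; case: ltnP => [_|Mk] /=; rewrite in_itv/= ?andbT; first by case/andP.
by have -> : k = M :> nat by apply/eqP; rewrite eqn_leq Mk -ltnS ltn_ord.
Qed.

Lemma cell_le (k : nat) y : (k < M)%N -> cell k y -> y <= k.+1%:R * delta.
Proof. by rewrite /cell => -> /=; rewrite in_itv/= => /andP[]. Qed.

Lemma cell_disj (i j : 'I_M.+1) : i != j -> cell i `&` cell j = set0.
Proof.
wlog ij : i j / (i < j)%N.
  move=> W; rewrite neq_ltn => /orP[h|h]; first by apply: W; rewrite // neq_ltn h.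
  by rewrite setIC; apply: W; rewrite // neq_ltn h.
move=> _; rewrite -subset0 => y [yi /cell_gt yj].
have iM : (i < M)%N by apply: (leq_trans ij); rewrite -ltnS.
have := lt_le_trans yj (cell_le iM yi).
by rewrite ltr_pM2r// ltr_nat ltnS leqNgt ij.
Qed.

Lemma cell_cover y : 0 < y -> exists k : 'I_M.+1, cell k y.
Proof.
move=> y0; have ex : exists k : nat, y <= k.+1%:R * delta.
  exists (Num.truncn (y / delta)); rewrite -ler_pdivrMr//; apply/ltW.
  exact: truncnS_gt.
have [Mlty|yM] := ltP (M%:R * delta) y.
  by exists ord_max; rewrite /cell ltnn /= in_itv/= andbT.
pose k := ex_minn ex; have [kM|Mk] := ltnP k M; last first.
  case: M yM Mk => [|m] yM Mk.
    by move: yM; rewrite mul0r leNgt y0.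
  by move: Mk; rewrite /k; case: ex_minnP => n _ /(_ m yM); lia.
exists (Ordinal (ltnW kM : (k < M.+1)%N)) => /=.
rewrite /cell kM /= in_itv/= /k; case: ex_minnP => -[|n] yn nmin.
  by rewrite mul0r y0.
rewrite yn andbT ltNge; apply/negP => /nmin; lia.
Qed.

Lemma sum_mass_ge r m : (m <= M)%N ->
  \sum_(k < M.+1 | (m <= k)%N) mass r k = expR (- (r * delta)) ^+ m.
Proof.
move=> mM; rewrite /mass; set x := expR _.
rewrite big_mkcond big_ord_recr/= ltnn subr0 mM -big_mkcond/=.
under eq_bigr => i _ do rewrite /= ltn_ord.
rewrite -(big_geq_mkord m M xpredT (fun i => x ^+ i - x ^+ i.+1)).
rewrite (telescope_sumr_eq (fun k => - x ^+ k))//; last by move=> k _; rewrite opprK addrC.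
by rewrite opprK addrAC addNr add0r.
Qed.

Lemma sum_mass r : \sum_k mass r k = 1.
Proof. by rewrite -(expr0 (expR (- (r * delta)))) -sum_mass_ge. Qed.

Lemma mass_ge0 r k : 0 <= r -> 0 <= mass r k.
Proof.
move=> r0; rewrite /mass; case: ifP => _; last by rewrite subr0 exprn_ge0 ?expR_ge0.
rewrite subr_ge0 exprS ler_piMl ?exprn_ge0 ?expR_ge0//.
by rewrite expR_le1 oppr_le0 mulr_ge0// ltW.
Qed.

End Grid.

Lemma pr_cell (R : realType) disp (Omega : measurableType disp)
    (P : probability Omega R) (Y : {RV P >-> R}) r delta M (k : 'I_M.+1) :
  0 < r -> 0 < delta ->
  (forall A, measurable A -> distribution P Y A = exponential_prob r A) ->
  pr P (Y @^-1` cell delta M k) = mass delta r k.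
Proof.
move=> r0 d0 law; have xE n : expR (- (r * delta)) ^+ n = expR (- (r * (n%:R * delta))).
  by rewrite -expRM_natl; congr expR; lra.
rewrite /cell /mass; case: ltnP => [kM|Mk].
  rewrite (pr_itvoc r0 law) ?xE//.
  by rewrite mulr_ge0 ?(ltW d0)// ler_pM2r// ler_nat leqnSn.
have -> : k = M :> nat by apply/eqP; rewrite eqn_leq Mk -ltnS ltn_ord.
by rewrite subr0 (pr_gt r0 law) ?xE// mulr_ge0// ltW.
Qed.

(** * Weighted trees of labels and their survival *)

(** The three clocks attached to a vertex: the chase and the spread coming from
    its parent, and its death. *)
Definition kchase : 'I_3 := inord 0.
Definition kdeath : 'I_3 := inord 1.
Definition kspread : 'I_3 := inord 2.

Section LabelledTrees.
Variables (d : nat) (L : finType).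

(** A tree of depth [k] in which every inner node carries the labels of its chase
    and death clocks, and every edge the label of its spread clock. Finite trees
    of labels make the law of the discretized clocks a finite weighted sum that
    factorizes along the branching. *)
Fixpoint ltree (k : nat) : finType :=
  if k is k'.+1 then ((L * L) * {ffun 'I_d -> L * ltree k'})%type : finType
  else unit.

Fixpoint clocks_of k (s : seq 'I_d) : ltree k -> seq ((seq 'I_d * 'I_3) * L) :=
  match k with
  | 0 => fun=> [::]
  | k'.+1 => fun t : ltree k'.+1 =>
      ((s, kchase), t.1.1) :: ((s, kdeath), t.1.2) ::
      flatten [seq ((i :: s, kspread), (t.2 i).1) :: clocks_of (i :: s) (t.2 i).2
              | i <- enum 'I_d]
  end.

Definition below (l : seq (seq 'I_d * 'I_3)) :=
  [seq (rcons q.1 i, q.2) | i <- enum 'I_d, q <- l].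

(** The indices of the clocks read by a tree of depth [k], as positions relative
    to its root. They do not depend on the labels, which makes the absence of
    repetitions an easy induction. *)
Fixpoint keys_of (k : nat) : seq (seq 'I_d * 'I_3) :=
  if k is k'.+1 then ([::], kchase) :: ([::], kdeath) ::
    below (([::], kspread) :: keys_of k')
  else [::].

Lemma unzip1_clocks_of k s (t : ltree k) :
  unzip1 (clocks_of s t) = [seq (q.1 ++ s, q.2) | q <- keys_of k].
Proof.
elim: k s t => [//|k IH] s t /=; congr [:: _, _ & _].
rewrite /unzip1 /below !map_flatten -!map_comp; congr flatten.
apply: eq_map => i /=; congr (_ :: _); rewrite -[LHS]/(unzip1 _) IH -map_comp.
by apply: eq_map => q /=; rewrite cat_rcons.
Qed.

Lemma uniq_keys k : uniq (keys_of k).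
Proof.
have notroot c l : ([::], c) \notin below l.
  by apply/negP => /allpairsPdep[i [q [_ _ []]]]; case: (q.1).
have nspread j : ([::], kspread) \notin keys_of j.
  case: j => [//|j] /=; rewrite !inE !xpair_eqE eqxx /= -!val_eqE /= !inordK//=.
elim: k => [//|k IH] /=.
rewrite inE !(negPf (notroot _ _)) xpair_eqE eqxx /= -val_eqE /= !inordK//=.
apply: allpairs_uniq; rewrite ?enum_uniq//=; first by rewrite nspread.
by move=> [i [q c]] [j [q' c']] _ _ /= [/rcons_inj[-> ->] ->].
Qed.

Variables (R : realType) (mk : 'I_3 -> L -> R).
Hypothesis mk_sum1 : forall c, \sum_a mk c a = 1.
Hypothesis mk_ge0 : forall c a, 0 <= mk c a.

Fixpoint weight k : ltree k -> R :=
  match k with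
  | 0 => fun=> 1
  | k'.+1 => fun t : ltree k'.+1 => mk kchase t.1.1 * mk kdeath t.1.2 *
      \prod_i (mk kspread (t.2 i).1 * weight (t.2 i).2)
  end.

Lemma weightE k s (t : ltree k) :
  weight t = \prod_(p <- clocks_of s t) mk p.1.2 p.2.
Proof.
elim: k s t => [|k IH] s t /=; first by rewrite big_nil.
rewrite !big_cons mulrA big_flatten big_map big_enum /=; congr (_ * _).
by apply: eq_bigr => i _; rewrite big_cons (IH (i :: s)).
Qed.

Lemma weight_ge0 k (t : ltree k) : 0 <= weight t.
Proof. by rewrite (weightE [::]) prodr_ge0. Qed.

Lemma sum_ltree k (Q : pred (ltree k.+1)) :
  \sum_(t | Q t) weight t = \sum_a \sum_b \sum_(f | Q ((a, b), f))
    (mk kchase a * mk kdeath b * \prod_i (mk kspread (f i).1 * weight (f i).2)).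
Proof.
rewrite big_mkcond /=.
under [RHS]eq_bigr => a _ do under eq_bigr => b _ do rewrite big_mkcond /=.
rewrite !pair_bigA /=; apply: eq_bigr => -[[a b] f] _ //=.
Qed.

Lemma sum_pair k (Q : pred (L * ltree k)) :
  \sum_(z | Q z) (mk kspread z.1 * weight z.2) =
  \sum_a mk kspread a * \sum_(t | Q (a, t)) weight t.
Proof.
under [RHS]eq_bigr => a _ do rewrite big_mkcond /= big_distrr /=.
rewrite pair_bigA /= big_mkcond /=; apply: eq_bigr => -[a t] _ /=.
by case: ifP; rewrite ?mulr0.
Qed.

Lemma sum_weight k : \sum_(t : ltree k) weight t = 1.
Proof.
elim: k => [|k IH].
  by rewrite (bigD1 tt)//= big1 ?addr0// => -[].
have one : \sum_(z : L * ltree k) (mk kspread z.1 * weight z.2) = 1.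
  rewrite (sum_pair predT) -[RHS](mk_sum1 kspread).
  by apply: eq_bigr => a _; rewrite IH mulr1.
rewrite (sum_ltree predT) -[RHS](mk_sum1 kchase); apply: eq_bigr => a _.
rewrite -[RHS]mulr1 -[in RHS](mk_sum1 kdeath) big_distrr /=; apply: eq_bigr => b _.
rewrite -big_distrr /= -(bigA_distr_bigA (fun _ z => mk kspread z.1 * weight z.2)).
by rewrite big1 ?mulr1// => i _; rewrite one.
Qed.

(** The subtrees of the children are independent: the [d] children all fail with
    the [d]-th power of the probability that one of them fails. *)
Lemma sum_some_child k (G : pred (L * ltree k)) :
  \sum_(f : {ffun 'I_d -> L * ltree k} | [exists i, G (f i)])
    \prod_i (mk kspread (f i).1 * weight (f i).2) =
  1 - (1 - \sum_(z | G z) (mk kspread z.1 * weight z.2)) ^+ d.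
Proof.
pose w (z : L * ltree k) := mk kspread z.1 * weight z.2.
have one : \sum_z w z = 1.
  rewrite (sum_pair predT) -[RHS](mk_sum1 kspread).
  by apply: eq_bigr => a _; rewrite sum_weight mulr1.
have tot : \sum_(f : {ffun 'I_d -> L * ltree k}) \prod_i w (f i) = 1.
  rewrite -(bigA_distr_bigA (fun _ z => w z)) big1// => i _.
have none : \sum_(f : {ffun 'I_d -> L * ltree k} | ~~ [exists i, G (f i)])
    \prod_i w (f i) = (1 - \sum_(z | G z) w z) ^+ d.
  have -> : 1 - \sum_(z | G z) w z = \sum_(z | ~~ G z) w z.
    by apply/eqP; rewrite subr_eq -one (bigID G predT) /= addrC.
  rewrite -[in RHS](card_ord d) -prodr_const.
  rewrite (bigA_distr_big (fun z => ~~ G z) (fun _ z => w z)).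
  apply: eq_bigl => f; rewrite negb_exists.
  by apply/forallP/ffun_onP => h i; have := h i.
rewrite -none; apply/eqP; rewrite eq_sym subr_eq; apply/eqP; rewrite -[LHS]tot.
by rewrite (bigID (fun f : {ffun 'I_d -> L * ltree k} => [exists i, G (f i)])).
Qed.

End LabelledTrees.

Section Survival.
Variables (d M e : nat).
Notation L := 'I_M.+1.

(** A sufficient condition, on labels, for blue to go [k] generations down. The
    number [j] is the nominal age of the root, in units of the mesh, when its
    parent turns blue; [t.1.1], [t.1.2] and [(t.2 i).1] are the labels of its
    chase clock, of its death clock and of the spread clock to its child [i]. The
    slack [e] absorbs the rounding errors accumulated on the way. *)
Fixpoint survives k (j : nat) : ltree d L k -> bool :=
  match k with
  | 0 => fun=> true
  | k'.+1 => fun t : ltree d L k'.+1 =>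
      (j + t.1.1 + e <= t.1.2)%N &&
      [exists i, ((t.2 i).1 + e <= j + t.1.1)%N &&
                 survives (j + t.1.1 - (t.2 i).1) (t.2 i).2]
  end.

Variables (R : realType) (mk : 'I_3 -> L -> R).
Hypothesis mk_sum1 : forall c, \sum_a mk c a = 1.
Hypothesis mk_ge0 : forall c a, 0 <= mk c a.

Definition survival k j : R := \sum_(t | @survives k j t) weight mk t.

(** Given the label [a] of the chase clock of the root, the children are
    independent, and the root has to outlive [j + a + e] units of time. *)
Lemma survivalS k j : survival k.+1 j =
  \sum_(a : L) mk kchase a * (\sum_(b : L | (j + a + e <= b)%N) mk kdeath b) *
    (1 - (1 - \sum_(c : L | (c + e <= j + a)%N)
                 mk kspread c * survival k (j + a - c)) ^+ d).
Proof.
rewrite /survival sum_ltree; apply: eq_bigr => a _ /=.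
rewrite mulrAC big_distrr /= [RHS]big_mkcond /=; apply: eq_bigr => b _.
case: ifP => _; last by rewrite big_pred0_eq.
rewrite -big_distrr /= mulrAC; congr (_ * _ * _).
rewrite (sum_some_child mk_sum1 (fun z => (z.1 + e <= j + a)%N &&
  survives (j + a - z.1) z.2)).
rewrite sum_pair /=; congr (1 - (1 - _) ^+ d).
rewrite [RHS]big_mkcond /=; apply: eq_bigr => c _.
by case: ifP => _ //=; rewrite big_pred0_eq mulr0.
Qed.

Lemma survival_ge0 k j : 0 <= survival k j.
Proof. by apply: sumr_ge0 => t _; exact: weight_ge0. Qed.

Lemma survival_le1 k j : survival k j <= 1.
Proof.
rewrite -(sum_weight d mk_sum1 k) [leRHS](bigID (@survives k j)) /= lerDl.
by apply: sumr_ge0 => t _; exact: weight_ge0.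
Qed.

(** The factor [x ^+ j] is the price for being alive at age [j]. Once it is taken
    out, the lack of memory of the geometric law makes the induction step
    independent of [j]: it is the hypothesis that bounds [q] by the expectation
    over the chase label [a] of the probability that one of the [d] children is
    infected in time, with an age [i] between [e] and [a], and then survives. *)
Lemma survival_lb (J : nat) (x q sigma : R) :
  0 <= x <= 1 -> 0 <= q <= 1 -> 0 <= sigma -> (2 * J + e <= M)%N ->
  (forall m, (m <= M)%N -> x ^+ m <= \sum_(b : L | (m <= b)%N) mk kdeath b) ->
  (forall c : L, (c < 2 * J)%N -> sigma <= mk kspread c) ->
  q <= \sum_(a : L | (a < J)%N) mk kchase a * x ^+ (a + e) *
    (1 - (1 - q * sigma * \sum_(e <= i < a.+1) x ^+ i) ^+ d) ->
  forall k j, (j < J)%N -> q * x ^+ j <= survival k j.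
Proof.
move=> /andP[x0 x1] /andP[q0 q1] s0 JM tail sp rec.
elim => [|k IH] j jJ.
  rewrite /survival (eq_bigl predT)// (sum_weight d mk_sum1 0).
  by rewrite mulr_ile1// ?exprn_ge0// exprn_ile1.
rewrite survivalS.
have cP (a : L) : 0 <= \sum_(c : L | (c + e <= j + a)%N)
    mk kspread c * survival k (j + a - c) <= 1.
  rewrite sumr_ge0/=; last by move=> c _; rewrite mulr_ge0// survival_ge0.
  rewrite -(mk_sum1 kspread) [leRHS](bigID (fun c : L => c + e <= j + a)%N) /=.
  rewrite ler_wpDr//; first by apply: sumr_ge0.
  by apply: ler_sum => c _; rewrite ler_piMr// survival_le1.
rewrite [leRHS](bigID (fun a : L => (a < J)%N)) /= ler_wpDr//.
  apply: sumr_ge0 => a _; have /andP[c0 c1] := cP a.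
  rewrite !mulr_ge0// ?sumr_ge0// subr_ge0 exprn_ile1//; lra.
rewrite mulrC; apply: (le_trans (ler_wpM2l (exprn_ge0 j x0) rec)).
rewrite big_distrr /=; apply: ler_sum => a aJ; have /andP[c0 c1] := cP a.
rewrite mulrA mulrCA -exprD.
have y0 : 0 <= q * sigma * \sum_(e <= i < a.+1) x ^+ i.
  by rewrite !mulr_ge0// sumr_ge0// => i _; rewrite exprn_ge0.
have yc : q * sigma * \sum_(e <= i < a.+1) x ^+ i <=
    \sum_(c : L | (c + e <= j + a)%N) mk kspread c * survival k (j + a - c).
  have [ae|ea] := ltnP a e; first by rewrite big_geq// mulr0.
  pose G c := mk kspread (inord c) * survival k (j + a - c).
  have G0 c : 0 <= G c by rewrite mulr_ge0// survival_ge0.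
  (* Only children whose spread cell is at least [j] are kept, so that the age
     of the child once its parent is blue is some [i <= a < J]. *)
  apply: (@le_trans _ _ (\sum_(j <= c < j + (a.+1 - e)) G c)); last first.
    rewrite (big_nat_widen _ _ M.+1); last by lia.
    rewrite (big_nat_widenl j 0)// big_mkord big_mkcond [leRHS]big_mkcond /=.
    apply: ler_sum => c _; rewrite /G inord_val.
    case: ifP => h; case: ifP => // h'; last by rewrite mulr_ge0// survival_ge0.
    by move: h h'; lia.
  have shift (F : nat -> R) m n : \sum_(m <= i < m + n) F i = \sum_(i < n) F (i + m)%N.
    by rewrite -{1}[m]add0n big_addn addKn big_mkord.
  rewrite shift big_nat_rev -[X in index_iota _ X](subnKC (leqW ea)) shift big_distrr /=.
  apply: ler_sum => i _.
  have [iM cJ] : (i + j < M.+1)%N /\ (i + j < 2 * J)%N by have := ltn_ord i; lia.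
  rewrite (_ : (e + a.+1 - (i + e).+1 = j + a - (i + j))%N); last by lia.
  rewrite [q * _]mulrC -mulrA; apply: ler_pM => //.
  - by rewrite mulr_ge0// exprn_ge0.
  - by apply: sp; rewrite inordK.
  - by apply: IH; have := ltn_ord i; lia.
apply: ler_pM.
- by rewrite mulr_ge0// exprn_ge0.
- rewrite subr_ge0 exprn_ile1//; lra.
- by rewrite addnA; apply: ler_wpM2l => //; apply: tail; lia.
- rewrite lerD2l lerN2; apply: lerXn2r; rewrite ?nnegrE; lra.
Qed.

End Survival.

(** * From labels to clocks *)

Definition key_transition d (key : seq 'I_d * 'I_3) : transition (vertex d) :=
  let: (s, c) := key in
  if c == kchase then Chase (par s) (Some s)
  else if c == kdeath then Death (Some s) else Spread (par s) (Some s).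

Lemma kdeathNchase : (kdeath == kchase) = false.
Proof. by rewrite -val_eqE /= !inordK. Qed.
Lemma kspreadNchase : (kspread == kchase) = false.
Proof. by rewrite -val_eqE /= !inordK. Qed.
Lemma kspreadNdeath : (kspread == kdeath) = false.
Proof. by rewrite -val_eqE /= !inordK. Qed.

Lemma key_cases (c : 'I_3) : [\/ c = kchase, c = kdeath | c = kspread].
Proof.
case: c => -[|[|[|//]]] lt3; [apply: Or31|apply: Or32|apply: Or33];
  by apply/val_inj; rewrite /= inordK.
Qed.

Lemma key_transition_inj d : injective (@key_transition d).
Proof.
move=> [s c] [s' c']; rewrite /key_transition.
by case: (key_cases c) => ->; case: (key_cases c') => ->;
  rewrite ?eqxx ?kdeathNchase ?kspreadNchase ?kspreadNdeath; congruence.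
Qed.

Section Cells.
Variables (R : realType) (d : nat) (clock : transition (vertex d) -> R).
Variable x : R -> vertex d -> state.
Hypothesis drv : driven_by (@tree_adj d) clock (@tree_init d) x.
Hypothesis rc : forall t v, 0 <= t -> \forall s \near t^'+, x s v = x t v.
Hypothesis clock_gt0 : forall tau, 0 < clock tau.
Hypothesis slow_spread : no_fast_ray (fun s => clock (Spread (Some s) (par s))).
Hypothesis slow_chase : no_fast_ray (fun s => clock (Chase (Some s) (par s))).
Variables (delta : R) (M : nat).
Hypothesis delta_gt0 : 0 < delta.

Definition in_cells (l : seq ((seq 'I_d * 'I_3) * 'I_M.+1)) : Prop :=
  forall p, p \in l -> cell delta M p.2 (clock (key_transition p.1)).

(** The true age [beta - r] is within [i] meshes of the nominal age after [i]
    generations, because each generation adds one chase clock and subtracts one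
    spread clock, both known up to one mesh. With slack [n.+1 > i] the inequalities
    between labels imply the strict inequalities between clocks that
    [chased_child] requires. *)
Lemma survives_blue (n k i j : nat) (s : seq 'I_d) (r beta : R)
    (t : ltree d 'I_M.+1 k) :
  chased x s r beta -> (i + k <= n)%N ->
  j%:R * delta - i%:R * delta <= beta - r <= j%:R * delta + i%:R * delta ->
  in_cells (clocks_of s t) -> survives n.+1 j t ->
  exists s', size s' = (size s + k)%N /\ exists2 u, 0 <= u & x u (par s') = Blue.
Proof.
elim: k i j s r beta t => [|k IH] i j s r beta t ch ikn.
  move=> _ _ _; exists s; rewrite addn0; split => //.
  have [/andP[r0 rb] pb _ _] := ch; have b0 := le_trans r0 rb.
  by exists beta => //; apply/pb.
pose a : 'I_M.+1 := t.1.1; pose b : 'I_M.+1 := t.1.2 => age inc /= /andP[].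
rewrite -/a -/b => jab /existsP[c].
pose z : 'I_M.+1 * ltree d 'I_M.+1 k := t.2 c; rewrite -/z => /andP[cc sv].
pose y : 'I_M.+1 := z.1; rewrite -/y in cc sv.
have cT : cell delta M a (clock (Chase (par s) (Some s))).
  by have := inc ((s, kchase), a); rewrite /= eqxx; apply; rewrite !inE eqxx.
have cD : cell delta M b (clock (Death (Some s))).
  have := inc ((s, kdeath), b); rewrite /= kdeathNchase eqxx; apply.
  by rewrite !inE eqxx orbT.
have sub p : p \in ((c :: s, kspread), z.1) :: clocks_of (c :: s) z.2 ->
    p \in clocks_of s t.
  move=> pin; rewrite /= !inE; do 2 (apply/orP; right).
  by apply/flatten_mapP; exists c; rewrite ?mem_enum.
have cS : cell delta M y (clock (Spread (par (c :: s)) (Some (c :: s)))).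
  have := inc _ (sub ((c :: s, kspread), z.1) (mem_head _ _)).
  by rewrite /= kspreadNchase kspreadNdeath.
have zM := ltn_ord y; have bM := ltn_ord b.
have aM : (a < M)%N by clear -jab bM; lia.
have z1M : (y < M)%N by clear -cc jab bM; lia.
have Tlo := cell_gt cT; have Thi := cell_le aM cT.
have Slo := cell_gt cS; have Shi := cell_le z1M cS.
have Dlo := cell_gt cD.
have nr (m1 m2 : nat) : (m1 <= m2)%N -> m1%:R * delta <= m2%:R * delta.
  by move=> m12; rewrite ler_pM2r// ler_nat.
have h1 := nr _ _ jab; have h2 := nr _ _ cc.
have h3 : (i.+1)%:R * delta <= n.+1%:R * delta by apply: nr; clear -ikn; lia.
have E : (j + a - y)%N%:R = j%:R + a%:R - y%:R :> R by rewrite natrB ?natrD//; clear -cc; lia.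
rewrite !natrD -!natr1 in h1 h2 h3 Thi Shi E.
have /andP[age1 age2] := age.
have alive : beta + clock (Chase (par s) (Some s)) < r + clock (Death (Some s)).
  lra.
have young : clock (Spread (par (c :: s)) (Some (c :: s)))
   < beta + clock (Chase (par s) (Some s)) - r.
  lra.
have ch' := chased_child drv rc clock_gt0 slow_spread slow_chase ch alive young.
have [||||s' [ss' hs']] := IH i.+1 (j + a - y)%N _ _ _ z.2 ch' => //.
- by clear -ikn; lia.
- rewrite E -natr1; apply/andP; split; lra.
- by move=> p pin; apply: inc; apply: sub; rewrite inE pin orbT.
by exists s'; rewrite ss' /= addSnnS.
Qed.

End Cells.

(** * Almost sure and path-indexed events *)

Section Events.
Context (R : realType) (disp : measure_display) (Omega : measurableType disp).
Variable P : probability Omega R.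

Lemma pr_indep_fin (I : Type) (Y : I -> {RV P >-> R}) (K : finType)
    (f : K -> I) (A : K -> set R) :
  independent_RVs Y -> injective f -> (forall k, measurable (A k)) ->
  pr P (\big[setI/setT]_k (Y (f k) @^-1` A k)) =
  \prod_k pr P (Y (f k) @^-1` A k).
Proof.
move=> ind finj mA.
have := @pr_indep _ _ _ P I Y K unit f [seq (k, tt) | k <- index_enum K]
  (fun k _ => A k) ind finj.
rewrite !big_map; apply => //.
rewrite /unzip1 -map_comp map_id; exact: index_enum_uniq.
Qed.

Lemma ae_all (T : countType) (Q : T -> Omega -> Prop) :
  (forall t, {ae P, forall w, Q t w}) -> {ae P, forall w, forall t, Q t w}.
Proof.
move=> H; pose Q' n w := if unpickle n is Some t then Q t w else True.
have : {ae P, forall w, forall n, Q' n w}.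
  by apply: ae_foralln => n; rewrite /Q'; case: unpickle => [t|]; [exact: H|exact: aeW].
by apply: filterS => w h t; have := h (pickle t); rewrite /Q' pickleK.
Qed.

Lemma ae_pr0 (Q : Omega -> Prop) (A : set Omega) : measurable A -> pr P A = 0 ->
  (forall w, ~ A w -> Q w) -> {ae P, forall w, Q w}.
Proof.
move=> mA pA AQ; exists A; split => //; first by rewrite prE// pA.
by move=> w /= nQ; apply: contrapT => /AQ.
Qed.

Lemma ae_null (Q : Omega -> Prop) : {ae P, forall w, Q w} ->
  exists2 N : set Omega, measurable N /\ pr P N = 0 & forall w, ~ N w -> Q w.
Proof.
move=> [N [mN N0 QN]]; exists N; first by split=> //; rewrite /pr N0.
by move=> w nN; apply: contrapT => nQ; apply: nN; apply: QN.
Qed.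

Lemma pr_tuples_le d n (Q : seq 'I_d -> set Omega) (b : R) :
  (forall p, measurable (Q p)) -> (forall p, size p = n -> pr P (Q p) <= b) ->
  pr P (\big[setU/set0]_(p : n.-tuple 'I_d) Q p) <= d%:R ^+ n * b.
Proof.
move=> mQ Qb; apply: le_trans (pr_bigsetU_le _ _ _ _) _ => //.
apply: (@le_trans _ _ (\sum_(p : n.-tuple 'I_d) b)).
  by apply: ler_sum => p _; apply: Qb; rewrite size_tuple.
by rewrite sumr_const card_tuple card_ord -natrX mulr_natl.
Qed.

Lemma pr_geo_eq0 (A : set Omega) (a : R) : 0 <= a < 1 ->
  (forall n, pr P A <= a ^+ n) -> pr P A = 0.
Proof.
move=> /andP[a0 a1] H; apply/eqP; rewrite eq_le pr_ge0 andbT.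
have a1' : `|a| < 1 by rewrite ger0_norm.
by apply: (cvgr_to_ge (cvg_expr a1')); near=> n; exact: H.
Unshelve. all: by end_near.
Qed.

End Events.

(** * The process on its probability space *)

Definition key_rate (R : realType) (lam rho : R) (c : 'I_3) : R :=
  if c == kchase then 1 else if c == kdeath then rho else lam.

Lemma rate_key (R : realType) (lam rho : R) d (p : seq 'I_d * 'I_3) :
  rate lam rho (key_transition p) = key_rate lam rho p.2.
Proof. by case: p => s c; rewrite /key_transition /key_rate; case: ifP => // _; case: ifP. Qed.

(** Hence distinct label trees correspond to disjoint events. *)
Lemma in_cells_inj (R : realType) d (clock : transition (vertex d) -> R)
    (delta : R) M k s (t t' : ltree d 'I_M.+1 k) : 0 < delta ->
  in_cells clock delta (clocks_of s t) -> in_cells clock delta (clocks_of s t') ->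
  t = t'.
Proof.
move=> delta0.
have eqc (a a' : 'I_M.+1) y : cell delta M a y -> cell delta M a' y -> a = a'.
  move=> ca ca'; apply/eqP/negP => /negP/(cell_disj delta0).
  by rewrite -subset0 => /(_ y); apply.
elim: k s t t' => [s [] []//|k IH] s t t' h h'.
have mem (u : ltree d 'I_M.+1 k.+1) c p :
    p \in ((c :: s, kspread), (u.2 c).1) :: clocks_of (c :: s) (u.2 c).2 ->
    p \in clocks_of s u.
  move=> pin; rewrite /= !inE; do 2 (apply/orP; right).
  by apply/flatten_mapP; exists c; rewrite ?mem_enum.
have e1 : t.1.1 = t'.1.1.
  apply: (eqc _ _ (clock (key_transition (s, kchase)))).
    by apply: (h ((s, kchase), t.1.1)); rewrite /= !inE eqxx.
  by apply: (h' ((s, kchase), t'.1.1)); rewrite /= !inE eqxx.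
have e2 : t.1.2 = t'.1.2.
  apply: (eqc _ _ (clock (key_transition (s, kdeath)))).
    by apply: (h ((s, kdeath), t.1.2)); rewrite /= !inE eqxx orbT.
  by apply: (h' ((s, kdeath), t'.1.2)); rewrite /= !inE eqxx orbT.
have e3 : t.2 = t'.2.
  apply/ffunP => c.
  have e4 : (t.2 c).1 = (t'.2 c).1.
    apply: (eqc _ _ (clock (key_transition (c :: s, kspread)))).
      by apply: (h ((c :: s, kspread), (t.2 c).1)); exact: (mem _ c _ (mem_head _ _)).
    by apply: (h' ((c :: s, kspread), (t'.2 c).1)); exact: (mem _ c _ (mem_head _ _)).
  have e5 : (t.2 c).2 = (t'.2 c).2.
    by apply: (IH (c :: s)) => p pin; [apply: h|apply: h']; apply: (mem _ c); exact: mem_behead.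
  by rewrite [t.2 c]surjective_pairing [t'.2 c]surjective_pairing e4 e5.
by rewrite [t]surjective_pairing [t.1]surjective_pairing e1 e2 e3 -!surjective_pairing.
Qed.

Lemma big_key (R : comPzRingType) (g : 'I_3 -> R) :
  \prod_c g c = g kchase * g kdeath * g kspread.
Proof.
rewrite !big_ord_recl big_ord0 mulr1 mulrA.
by congr (g _ * g _ * g _); apply/val_inj; rewrite /= inordK.
Qed.

Section Process.
Variables (R : realType) (lam rho : R) (d : nat).
Hypotheses (lam_gt0 : 0 < lam) (rho_gt0 : 0 < rho).
Context (disp : measure_display) (Omega : measurableType disp).
Variables (P : probability Omega R) (X : R -> Omega -> vertex d -> state).
Hypothesis mX : forall t v a, 0 <= t -> measurable [set w | X t w v = a].
Hypothesis rcX : forall w t v, 0 <= t -> \forall s \near t^'+, X s w v = X t w v.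

Definition blue_beyond n : set Omega :=
  [set w | exists s t, [/\ (n <= size s)%N, 0 <= t & X t w (Some s) = Blue]].

(** A colour, once taken, is kept for a while by right-continuity, hence can be
    observed at a rational time. *)
Lemma ever_blue_rat w v t : 0 <= t -> X t w v = Blue ->
  exists q : rat, 0 <= ratr q :> R /\ X (ratr q) w v = Blue.
Proof.
move=> t0 xt; have := rcX w v t0; rewrite near_withinE => -[e /= e0 he].
have te : t < t + e by rewrite ltrDl.
have [q] := rat_in_itvoo te; rewrite in_itv/= => /andP[tq qe].
exists q; split; first exact: le_trans (ltW tq).
rewrite -xt; apply: he => //.
by rewrite /ball/= distrC ger0_norm ?subr_ge0 ?(ltW tq)// ltrBlDl.
Qed.

Lemma measurable_ever_blue v : measurable [set w | ever_blue X w v].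
Proof.
have -> : [set w | ever_blue X w v] =
    \bigcup_(q : rat) [set w | 0 <= ratr q :> R /\ X (ratr q) w v = Blue].
  apply/seteqP; split => w.
    by move=> [t t0 /(ever_blue_rat t0)[q [q0 xq]]]; exists q.
  by move=> [q _ [q0 xq]]; exists (ratr q).
apply: bigcupT_measurable_rat => q.
have [q0|q0] := leP (0 : R) (ratr q).
  rewrite (_ : [set _ | _] = [set w | X (ratr q) w v = Blue]); first exact: mX.
  by apply/seteqP; split => w //= [].
rewrite (_ : [set _ | _] = set0)//; apply/seteqP; split => w //= -[+ _].
by [].
Qed.

(** The tree is locally finite, so infinitely many vertices are blue if and only
    if there are blue vertices at arbitrarily large depth. *)
Lemma infinitely_many_blueE : infinitely_many_blue X = \bigcap_n blue_beyond n.
Proof.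
apply/seteqP; split => w /=.
  move=> inf n _; apply: contrapT => H; apply: inf.
  apply: (@sub_finite_set _ _ ([set None] `|`
     [set Some (s : seq 'I_d) | s in range (@bseqval n 'I_d)])).
    case=> [s|] [t t0 xt]; [right|by left].
    exists s => //; have sn : (size s <= n)%N.
      by rewrite leqNgt; apply/negP => ns; apply: H; exists s, t; split => //; apply: ltnW.
    by exists (Bseq sn).
  rewrite finite_setU; split; first exact: finite_set1.
  by do 2 apply: finite_image; exact: finite_finset.
move=> H /finite_seqP[l El].
have [s [t [s0 t0 xt]]] := H (\max_(v <- l) (if v is Some s then size s else 0%N)).+1 I.
have : ([set` l] : set _) (Some s) by rewrite -El; exists t.
rewrite /= => sl; rewrite ltnNge in s0; move/negP: s0; apply.
exact: (@leq_bigmax_seq _ l xpredT (fun v => if v is Some s then size s else 0%N) (Some s) sl isT).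
Qed.

Lemma measurable_blue_beyond n : measurable (blue_beyond n).
Proof.
have -> : blue_beyond n = \bigcup_(s : seq 'I_d)
    [set w | (n <= size s)%N /\ ever_blue X w (Some s)].
  apply/seteqP; split => w.
    by move=> [s [t [ns t0 xt]]]; exists s => //; split => //; exists t.
  by move=> [s _ [ns [t t0 xt]]]; exists s, t.
apply: countable_bigcupT_measurable => // s.
have [ns|sn] := leqP n (size s).
  rewrite (_ : [set _ | _] = [set w | ever_blue X w (Some s)]).
    exact: measurable_ever_blue.
  by apply/seteqP; split => w //= [].
rewrite (_ : [set _ | _] = set0)//; apply/seteqP; split => w //= -[+ _].
by [].
Qed.

Variable clock : transition (vertex d) -> {RV P >-> R}.
Hypothesis ind : independent_RVs clock.
Hypothesis law : forall tau A, measurable A ->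
  distribution P (clock tau) A = exponential_prob (rate lam rho tau) A.
Hypothesis drvX : {ae P, forall w, driven_by (@tree_adj d) (fun tau => clock tau w)
  (@tree_init d) (fun t => X t w)}.

Lemma rate_gt0 (tau : transition (vertex d)) : 0 < rate lam rho tau.
Proof. by case: tau. Qed.

Lemma clock_gt0_ae tau : {ae P, forall w, 0 < clock tau w}.
Proof.
apply: (@ae_pr0 _ _ _ _ _ (clock tau @^-1` `]-oo, 0])).
- exact: measurable_RV.
- by rewrite (pr_le (rate_gt0 tau) (law tau))// mulr0 oppr0 expR0 subrr.
- by move=> w /=; rewrite in_itv/= => /negP; rewrite -ltNge.
Qed.

Lemma clocks_gt0_ae : {ae P, forall w, forall tau, 0 < clock tau w}.
Proof.
have hS : {ae P, forall w, forall uv : vertex d * vertex d,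
    0 < clock (Spread uv.1 uv.2) w} by apply: ae_all => uv; exact: clock_gt0_ae.
have hC : {ae P, forall w, forall uv : vertex d * vertex d,
    0 < clock (Chase uv.1 uv.2) w} by apply: ae_all => uv; exact: clock_gt0_ae.
have hD : {ae P, forall w, forall v : vertex d, 0 < clock (Death v) w}.
  by apply: ae_all => v; exact: clock_gt0_ae.
apply: filterS3 hS hC hD => w hS hC hD [u v|u v|v //].
- exact: (hS (u, v)).
- exact: (hC (u, v)).
Qed.

(** First-moment bound: with [eps] so small that [d * (r * eps) <= 1 / 2], some
    descending path of length [n] from [s] has all its clocks below [eps] with
    probability at most [2 ^- n]. *)
Lemma no_fast_ray_ae (C : seq 'I_d -> transition (vertex d)) (r : R) :
  injective C -> (forall s, rate lam rho (C s) = r) ->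
  {ae P, forall w, no_fast_ray (fun s => clock (C s) w)}.
Proof.
move=> Cinj rC; have r0 : 0 < r by rewrite -(rC [::]) rate_gt0.
pose eps := (2 * (d%:R + 1) * r)^-1.
have d0 : 0 <= d%:R :> R by [].
have den : 0 < 2 * (d%:R + 1) * r by rewrite !mulr_gt0// ltr_wpDl.
have eps0 : 0 < eps by rewrite invr_gt0.
have reps : d%:R * (r * eps) <= 2^-1.
  rewrite /eps mulrA ler_pdivrMr//.
  by rewrite -mulrA mulKf// mulrDl mul1r lerDl ltW.
clearbody eps.
pose fast s := clock (C s) @^-1` `]-oo, eps].
have mfast s : measurable (fast s) by exact: measurable_RV.
have pfast s : pr P (fast s) <= r * eps.
  have lawr A : measurable A -> distribution P (clock (C s)) A = exponential_prob r A.
    by move=> mA; rewrite law// rC.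
  rewrite (pr_le r0 lawr (ltW eps0)).
  by rewrite lerBlDl -lerBlDr; exact: expR_ge1Dx.
pose Q s n p := \big[setI/setT]_(i < n) fast (drop i p ++ s).
have mQ s n p : measurable (Q s n p) by exact: bigsetI_measurable.
have pQ s n p : size p = n -> pr P (Q s n p) <= (r * eps) ^+ n.
  move=> sp; rewrite (pr_indep_fin (f := fun i : 'I_n => C (drop i p ++ s))
    (A := fun=> [set` `]-oo, eps]]))//.
    rewrite -[in leRHS](card_ord n) -prodr_const; apply: ler_prod => i _.
    by rewrite pr_ge0 pfast.
  move=> i j /Cinj /(congr1 size); rewrite !size_cat !size_drop sp => E.
  by apply/val_inj => /=; have := ltn_ord i; have := ltn_ord j; lia.
pose F s n := \big[setU/set0]_(p : n.-tuple 'I_d) Q s n p.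
have mF s n : measurable (F s n) by exact: bigsetU_measurable.
have H s : {ae P, forall w, exists n, forall p, size p = n ->
    exists2 i, (i < n)%N & eps <= clock (C (drop i p ++ s)) w}.
  apply: (@ae_pr0 _ _ _ _ _ (\bigcap_n F s n)).
  - exact: bigcapT_measurable.
  - apply: (@pr_geo_eq0 _ _ _ _ _ 2^-1); first by lra.
    move=> n; apply: (@le_trans _ _ (pr P (F s n))).
      by apply: pr_mono => //; [exact: bigcapT_measurable|exact: bigcap_inf].
    apply: le_trans (pr_tuples_le (mQ s n) (pQ s n)) _.
    by rewrite -exprMn lerXn2r ?nnegrE ?mulr_ge0 ?(ltW r0) ?(ltW eps0)//; lra.
  - move=> w nF; apply: contrapT => nex; apply: nF => n _.
    have [p sp hp] : exists2 p : seq 'I_d, size p = n &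
        forall i, (i < n)%N -> clock (C (drop i p ++ s)) w <= eps.
      apply: contrapT => np; apply: nex; exists n => p sp.
      apply: contrapT => ni; apply: np; exists p => // i iN.
      by rewrite leNgt; apply/negP => /ltW el; apply: ni; exists i.
    rewrite /F -bigcup_seq; exists (tcast sp (in_tuple p)); first exact: mem_index_enum.
    rewrite /Q -bigcap_seq => i _; rewrite /fast /= val_tcast in_itv /=.
    exact: hp.
apply: filterS (ae_all H) => w hw; exists eps => //.
Qed.

(** The almost sure properties under which the lemmas on a single path of the
    process apply. *)
Definition good w := [/\ driven_by (@tree_adj d) (fun tau => clock tau w)
    (@tree_init d) (fun t => X t w), forall tau, 0 < clock tau w,
  no_fast_ray (fun s => clock (Spread (Some s) (par s)) w) &
  no_fast_ray (fun s => clock (Chase (Some s) (par s)) w)].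

Lemma good_ae : {ae P, forall w, good w}.
Proof.
have hS : {ae P, forall w, no_fast_ray (fun s => clock (Spread (Some s) (par s)) w)}.
  by apply: (@no_fast_ray_ae _ lam) => // s s' [].
have hC : {ae P, forall w, no_fast_ray (fun s => clock (Chase (Some s) (par s)) w)}.
  by apply: (@no_fast_ray_ae _ 1) => // s s' [].
have h1 : {ae P, forall w, driven_by (@tree_adj d) (fun tau => clock tau w)
   (@tree_init d) (fun t => X t w) /\ forall tau, 0 < clock tau w}.
  by apply: filterS2 drvX clocks_gt0_ae => w.
by apply: filterS3 h1 hS hC => w [].
Qed.

Lemma key_rate_gt0 c : 0 < key_rate lam rho c.
Proof. by rewrite /key_rate; case: ifP => // _; case: ifP. Qed.

Section Lower.
Variables (delta : R) (M : nat).
Hypothesis delta_gt0 : 0 < delta.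
Notation mk := (fun c : 'I_3 => @mass R delta M (key_rate lam rho c)).

Definition tree_event k (t : ltree d 'I_M.+1 k) : set Omega :=
  \big[setI/setT]_(p <- clocks_of [::] t)
    (clock (key_transition p.1) @^-1` cell delta M p.2).

Lemma measurable_tree_event k (t : ltree d 'I_M.+1 k) : measurable (tree_event t).
Proof.
by apply: bigsetI_measurable => p _; apply: measurable_RV; exact: measurable_cell.
Qed.

Lemma tree_eventP k (t : ltree d 'I_M.+1 k) w : tree_event t w ->
  in_cells (fun tau => clock tau w) delta (clocks_of [::] t).
Proof. by rewrite /tree_event -bigcap_seq => h p; exact: h. Qed.

Lemma pr_tree_event k (t : ltree d 'I_M.+1 k) :
  pr P (tree_event t) = weight mk t.
Proof.
rewrite /tree_event (pr_indep (A := fun _ (a : 'I_M.+1) => cell delta M a) ind).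
- rewrite (weightE _ [::]); apply: eq_bigr => p _.
  rewrite (pr_cell (r := key_rate lam rho p.1.2)) ?key_rate_gt0//.
  by move=> A mA; rewrite law// rate_key.
- exact: key_transition_inj.
- rewrite unzip1_clocks_of map_inj_in_uniq ?uniq_keys// => -[q c] [q' c'] _ _ /=.
  by rewrite !cats0.
- by move=> _ a; exact: measurable_cell.
Qed.

(** The events that the discretized clocks follow a given label tree are disjoint
    and have the weights of the trees as probabilities. Each surviving tree of
    depth [n.+1] forces a blue vertex at depth [n]; the slack [n.+2] exceeds the
    number of generations. *)
Lemma pr_blue_beyond_ge n :
  survival d (n.+2) mk n.+1 0 <= pr P (blue_beyond n).
Proof.
have [N [mN N0] goodN] := ae_null good_ae.
rewrite -[leRHS]addr0 -N0.
apply: le_trans (pr_setU_le _ _ _) => //; last exact: measurable_blue_beyond.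
rewrite /survival.
have -> : \sum_(t | @survives d M n.+2 n.+1 0 t) weight mk t =
    pr P (\big[setU/set0]_(t | @survives d M n.+2 n.+1 0 t) tree_event t).
  rewrite pr_bigsetU.
  - by apply: eq_bigr => t _; rewrite pr_tree_event.
  - by move=> t; exact: measurable_tree_event.
  - move=> t t' tt'; rewrite -subset0 => w [/tree_eventP h /tree_eventP h'].
    by move: tt'; rewrite (in_cells_inj delta_gt0 h h') eqxx.
have mB := measurable_blue_beyond n.
apply: pr_mono.
- by apply: bigsetU_measurable => t _; exact: measurable_tree_event.
- exact: measurableU.
move=> w; elim/big_ind: _ => //.
  by move=> A B hA hB [/hA|/hB].
move=> t sv /tree_eventP inc.
have [Nw|nN] := pselect (N w); [by right|left].
have [drv pos ss sc] := goodN _ nN.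
have ch := chased_root drv (rcX w).
have [||s' [ss' [u u0 xu]]] :=
  survives_blue (n := n.+1) (i := 0) drv (rcX w) pos ss sc delta_gt0 ch _ _ inc sv => //.
  by rewrite !mul0r subr0 addr0 lexx.
case: s' ss' xu => //= c s' [ss'] xu.
by exists s', u; rewrite ss'.
Qed.

End Lower.

(** Continuity from above along the decreasing events [blue_beyond n]. *)
Lemma pr_infinitely_many_blue_ge q : (forall n, q <= pr P (blue_beyond n)) ->
  q <= pr P (infinitely_many_blue X).
Proof.
move=> H; rewrite infinitely_many_blueE.
have mB := measurable_blue_beyond.
have mI : measurable (\bigcap_n blue_beyond n) by exact: bigcapT_measurable.
have := @nonincreasing_cvg_mu _ _ _ P (blue_beyond).
move=> /(_ _ mB mI) cv; rewrite -lee_fin -prE//.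
have cvB : P \o blue_beyond @ \oo --> P (\bigcap_n blue_beyond n).
  apply: cv; first by rewrite (le_lt_trans (probability_le1 _ _)) ?ltry.
  move=> m n mn; apply/subsetPset => w [s [t [ns t0 xt]]].
  by exists s, t; split => //; apply: leq_trans ns.
have <- := cvg_lim _ cvB; last exact: ereal_hausdorff.
apply: lime_ge; first by apply/cvg_ex; eexists; exact: cvB.
by apply: nearW => n; rewrite /= prE// lee_fin.
Qed.

Section Upper.
Variables (delta : R) (M : nat).
Hypothesis delta_gt0 : 0 < delta.

(** What a clock not exceeding one in the cell [k] satisfies. *)
Definition up_cell (k : nat) : set R :=
  if (k < M)%N then [set` `]-oo, k.+1%:R * delta]] else setT.

Lemma measurable_up_cell k : measurable (up_cell k).
Proof. by rewrite /up_cell; case: ifP. Qed.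

Lemma pr_up_cell tau (k : nat) : pr P (clock tau @^-1` up_cell k) <=
  (if (k < M)%N then rate lam rho tau * (k.+1%:R * delta) else 1).
Proof.
rewrite /up_cell; case: ifP => _; last by rewrite preimage_setT prT.
rewrite (pr_le (rate_gt0 tau) (law tau)); last first.
  by rewrite mulr_ge0// ltW.
by rewrite lerBlDl -lerBlDr; exact: expR_ge1Dx.
Qed.

(** The clocks met along the path from the root to [p]. The vertex
    [drop i.+1 p] is the parent of [drop i p], and the level [i] uses the chase and
    death clocks of the former and the spread clock of the latter. The shift is
    what makes different levels use different clocks. *)
Definition path_clock (p : seq 'I_d) n (z : 'I_n * 'I_3) : transition (vertex d) :=
  key_transition (drop (if z.2 == kspread then z.1 : nat else z.1.+1) p, z.2).

Lemma path_clock_inj p n : size p = n -> injective (@path_clock p n).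
Proof.
move=> sp [i c] [i' c'] /key_transition_inj [+ cc].
rewrite cc => /(congr1 size); rewrite !size_drop sp => E; congr pair.
apply/val_inj => /=; have := ltn_ord i; have := ltn_ord i'; move: E.
by case: ifP => _; lia.
Qed.

Definition path_set (k : nat) (c : 'I_3) : set R :=
  if c == kdeath then cell delta M k else up_cell k.

Definition path_event n (p : seq 'I_d) (kap : {ffun 'I_n -> 'I_M.+1}) : set Omega :=
  \big[setI/setT]_(z : 'I_n * 'I_3) (clock (path_clock p z) @^-1` path_set (kap z.1) z.2).

(** Given that the death clock is in the cell [k], the spread and chase clocks
    fall below it with probability at most [lam * ((k + 1) * delta) ^ 2]. The sum
    over [k] is a discrete version of the bound by the expectation of
    [lam * D ^ 2], that is [2 * lam / rho ^ 2], for [D] exponential of rate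
    [rho]. *)
Definition level_bound (k : 'I_M.+1) : R :=
  mass delta rho k * (if (k < M)%N then lam * (k.+1%:R * delta) ^+ 2 else 1).

Lemma measurable_path_set k c : measurable (path_set k c).
Proof.
by rewrite /path_set; case: ifP => _; [exact: measurable_cell|exact: measurable_up_cell].
Qed.

Lemma measurable_path_event n p (kap : {ffun 'I_n -> 'I_M.+1}) :
  measurable (path_event p kap).
Proof.
by apply: bigsetI_measurable => z _; apply: measurable_RV; exact: measurable_path_set.
Qed.

Lemma pr_path_event n p (kap : {ffun 'I_n -> 'I_M.+1}) : size p = n ->
  pr P (path_event p kap) <= \prod_i level_bound (kap i).
Proof.
move=> sp; rewrite /path_event (pr_indep_fin (f := @path_clock p n)
  (A := fun z => path_set (kap z.1) z.2) ind); first last.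
- by move=> z; exact: measurable_path_set.
- exact: path_clock_inj.
rewrite -(pair_bigA _ (fun i c =>
  pr P (clock (path_clock p (i, c)) @^-1` path_set (kap i) c))) /=.
apply: ler_prod => i _; rewrite prodr_ge0 => [/=|c _]; last exact: pr_ge0.
rewrite big_key /path_set eqxx [kchase == _]eq_sym kdeathNchase kspreadNdeath.
rewrite (pr_cell (r := rho))//; last by move=> A mA; rewrite law// rate_key /key_rate kdeathNchase eqxx.
rewrite mulrAC mulrC /level_bound ler_wpM2l ?mass_ge0 ?(ltW rho_gt0)//.
have rateE q c : rate lam rho (key_transition (q, c)) = key_rate lam rho c.
  by rewrite rate_key.
have := pr_up_cell (path_clock p (i, kchase)) (kap i).
have := pr_up_cell (path_clock p (i, kspread)) (kap i).
rewrite !rateE /key_rate eqxx kspreadNchase kspreadNdeath.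
have g0 c := pr_ge0 P (clock (path_clock p (i, c)) @^-1` up_cell (kap i)).
case: ifP => _ hS hT; last by rewrite mulr_ile1 ?g0.
by rewrite mul1r in hT; rewrite expr2 mulrCA; apply: ler_pM; rewrite ?g0.
Qed.

(** By [blue_TD] and [blue_parent], along the path to a blue vertex each death
    clock dominates the chase clock at the same vertex and the spread clock to the
    next one. *)
Lemma blue_beyond_path n w : good w -> blue_beyond n w ->
  exists (p : n.-tuple 'I_d) (kap : {ffun 'I_n -> 'I_M.+1}), path_event p kap w.
Proof.
move=> [drv pos ss sc] [s [t [ns t0 xt]]].
have sp : size (drop (size s - n) s) = n by rewrite size_drop subKn.
pose p := tcast sp (in_tuple (drop (size s - n) s)).
have bp m : eventually_blue (X^~ w) (drop m p).
  rewrite val_tcast /= drop_drop.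
  by apply: (eventually_blue_drop drv (rcX w) pos ss sc); exists t.
have /choice[kap hk] (i : 'I_n) : exists k : 'I_M.+1,
    cell delta M k (clock (Death (Some (drop i.+1 p))) w).
  by apply: cell_cover.
exists p, (finfun kap); rewrite /path_event -bigcap_seq => -[i c] _.
rewrite /= ffunE /path_set; have := hk i; move: (kap i) => k hki.
have up y : y <= clock (Death (Some (drop i.+1 p))) w -> up_cell k y.
  rewrite /up_cell; case: ifP => // kM; rewrite /= in_itv/= => yD.
  exact: le_trans yD (cell_le kM hki).
have TD := blue_TD drv (rcX w) pos ss sc (bp i.+1).
have SD : clock (Spread (par (drop i p)) (Some (drop i p))) w <=
    clock (Death (Some (drop i.+1 p))) w.
  have := bp i; have : (0 < size (drop i p))%N by rewrite size_drop size_tuple subn_gt0.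
  have -> : drop i.+1 p = behead (drop i p) by rewrite -drop1 drop_drop.
  case: (drop i p) => // c' q _ /(blue_parent drv (rcX w) pos ss sc)[_].
  by [].
rewrite /path_clock /=; case: (key_cases c) => ->.
- rewrite [kchase == kdeath]eq_sym [kchase == kspread]eq_sym kdeathNchase kspreadNchase eqxx.
  exact: up.
- by rewrite eqxx [kdeath == kspread]eq_sym kspreadNdeath kdeathNchase.
- by rewrite !kspreadNdeath kspreadNchase eqxx; exact: up.
Qed.

Lemma pr_blue_beyond_le n :
  pr P (blue_beyond n) <= (d%:R * \sum_k level_bound k) ^+ n.
Proof.
have [N [mN N0] goodN] := ae_null good_ae.
pose Q (p : seq 'I_d) : set Omega :=
  \big[setU/set0]_(kap : {ffun 'I_n -> 'I_M.+1}) path_event p kap.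
have mQ p : measurable (Q p).
  by apply: bigsetU_measurable => kap _; exact: measurable_path_event.
pose F := \big[setU/set0]_(p : n.-tuple 'I_d) Q p.
have mF : measurable F by exact: bigsetU_measurable.
apply: (@le_trans _ _ (pr P (F `|` N))).
  apply: pr_mono; [exact: measurable_blue_beyond|exact: measurableU|].
  move=> w bw; have [Nw|nN] := pselect (N w); [by right|left].
  have [p [kap hp]] := blue_beyond_path (goodN _ nN) bw.
  rewrite /F -bigcup_seq; exists p; first exact: mem_index_enum.
  by rewrite /Q -bigcup_seq; exists kap; first exact: mem_index_enum.
apply: (le_trans (pr_setU_le _ _ _)) => //; rewrite N0 addr0 exprMn.
apply: pr_tuples_le => // p sp.
apply: le_trans (pr_bigsetU_le _ _ _ _) _.
  by move=> kap; exact: measurable_path_event.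
apply: (@le_trans _ _ (\sum_(kap : {ffun 'I_n -> 'I_M.+1}) \prod_i level_bound (kap i))).
  by apply: ler_sum => kap _; exact: pr_path_event.
rewrite -(bigA_distr_bigA (fun _ k => level_bound k)).
by rewrite prodr_const card_ord.
Qed.

End Upper.

End Process.

(** * Choice of the grid: upper bound *)

Lemma expRN_le (R : realType) (y : R) : 0 <= y -> expR (- y) <= (1 + y)^-1.
Proof.
move=> y0; rewrite expRN lef_pV2 ?posrE ?expR_gt0//; last by lra.
exact: expR_ge1Dx.
Qed.

(** The second summand is the remainder of the series of general term
    [(1 - x) ^+ 3 * x ^+ k * (k + 1) ^ 2], whose sum is [1 + x]. *)
Lemma sum_sqr_geometric (R : realFieldType) (x : R) M :
  \sum_(k < M) (1 - x) ^+ 3 * (x ^+ k * k.+1%:R ^+ 2) +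
    x ^+ M * (1 + x + 2 * M%:R * (1 - x) + M%:R ^+ 2 * (1 - x) ^+ 2) = 1 + x.
Proof.
elim: M => [|M IH]; first by rewrite big_ord0 expr0; ring.
rewrite big_ord_recr /= (exprS x M) -(natr1 M); apply: etrans IH.
by set S := \sum_(i < M) _; ring.
Qed.

Lemma sum_sqr_geometric_le (R : realFieldType) (x : R) M : 0 <= x < 1 ->
  \sum_(k < M) (x ^+ k - x ^+ k.+1) * k.+1%:R ^+ 2 <= 2 / (1 - x) ^+ 2.
Proof.
move=> /andP[x0 x1]; rewrite ler_pdivlMr ?exprn_gt0 ?subr_gt0//.
have := sum_sqr_geometric x M.
have : 0 <= x ^+ M * (1 + x + 2 * M%:R * (1 - x) + M%:R ^+ 2 * (1 - x) ^+ 2).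
  by rewrite mulr_ge0 ?exprn_ge0// !addr_ge0 ?mulr_ge0 ?exprn_ge0//; lra.
have -> : (\sum_(k < M) (x ^+ k - x ^+ k.+1) * k.+1%:R ^+ 2) * (1 - x) ^+ 2 =
    \sum_(k < M) (1 - x) ^+ 3 * (x ^+ k * k.+1%:R ^+ 2).
  by rewrite big_distrl; apply: eq_bigr => k _ /=; rewrite exprS; ring.
lra.
Qed.

Lemma exists_expr_le (R : realType) (x b : R) : 0 <= x < 1 -> 0 < b ->
  exists M, x ^+ M <= b.
Proof.
move=> /andP[x0 x1] b0; have nx : `|x| < 1 by rewrite ger0_norm.
have /cvgrPdist_le /(_ b b0) [N _ hN] := cvg_expr nx.
exists N; have := hN N (leqnn N).
by rewrite /= sub0r normrN ger0_norm ?exprn_ge0.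
Qed.

Lemma quadratic_slack (R : realFieldType) (a : R) : 0 <= a < 1 ->
  a * (1 + (1 - a) / 12) ^+ 2 + (1 - a) / 4 < 1.
Proof.
move=> /andP[a0 a1]; pose b := 1 - a.
have -> : a = 1 - b by rewrite /b; ring.
have b0 : 0 < b by rewrite /b; lra.
have b1 : b <= 1 by rewrite /b; lra.
clearbody b; rewrite -subr_gt0.
have -> : 1 - ((1 - b) * (1 + (1 - (1 - b)) / 12) ^+ 2 + (1 - (1 - b)) / 4) =
  b * (84 + 23 * b + b * b) / 144 by field.
by rewrite divr_gt0 ?mulr_gt0//; have := mulr_ge0 (ltW b0) (ltW b0); lra.
Qed.

(** As the mesh tends to 0 and [M] to infinity the sum of [level_bound] tends to a
    limit at most [2 * lam / rho ^ 2]. Here [h] is the mesh in units of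
    [1 / rho], chosen in terms of the gap [1 - a]; a quarter of the gap goes to the
    mesh and a quarter to the unbounded cell. *)
Lemma exists_level_bound (R : realType) (lam rho : R) (d : nat) :
  0 < lam -> 0 < rho -> 2 * lam * d%:R < rho ^+ 2 ->
  exists delta M, 0 < delta /\
    d%:R * \sum_k level_bound lam rho delta (M := M) k < 1.
Proof.
move=> l0 r0 dl.
pose a := 2 * lam * d%:R / rho ^+ 2.
have r20 : 0 < rho ^+ 2 by rewrite exprn_gt0.
have a1 : a < 1 by rewrite /a ltr_pdivrMr// mul1r.
have a0 : 0 <= a by rewrite /a divr_ge0 ?mulr_ge0// ltW.
pose h := (1 - a) / 12; have h0 : 0 < h by rewrite /h; lra.
pose delta := h / rho; have d0 : 0 < delta by rewrite divr_gt0.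
have rd : rho * delta = h by rewrite /delta mulrC divfK// gt_eqF.
pose x := expR (- h).
have x0 : 0 <= x by exact: expR_ge0.
have x1 : x < 1 by rewrite /x expR_lt1 oppr_lt0.
have [M hM] : exists M : nat, d%:R * x ^+ M <= (1 - a) / 4.
  have D0 : 0 < d%:R + 1 :> R by rewrite ltr_wpDl.
  have [M hM] : exists M, x ^+ M <= (1 - a) / 4 / (d%:R + 1).
    by apply: exists_expr_le; rewrite ?x0// !divr_gt0// subr_gt0.
  exists M; rewrite ler_pdivlMr// in hM; apply: le_trans hM.
  by rewrite mulrDr mulr1 mulrC lerDl exprn_ge0.
exists delta, M; split => //.
have hx : delta / (1 - x) <= (1 + h) / rho.
  rewrite ler_pdivrMr ?subr_gt0// mulrAC ler_pdivlMr// [delta * _]mulrC rd.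
  have := expRN_le (ltW h0); rewrite -/x => xle.
  rewrite -ler_pdivrMl; last by lra.
  rewrite (_ : (1 + h)^-1 * h = 1 - (1 + h)^-1); last by field; lra.
  lra.
have sum_le : \sum_k level_bound lam rho delta (M := M) k <=
    lam * delta ^+ 2 * (2 / (1 - x) ^+ 2) + x ^+ M.
  rewrite /level_bound big_ord_recr /= {2}/mass /= ltnn mulr1 subr0 rd -/x lerD2r.
  apply: le_trans (ler_wpM2l _ (sum_sqr_geometric_le M (introT andP (conj x0 x1)))).
    rewrite big_distrr /=; apply: ler_sum => k _.
    by rewrite /mass /= !ltn_ord rd -/x exprMn; lra.
  by rewrite mulr_ge0 ?exprn_ge0// ltW.
have main : d%:R * (lam * delta ^+ 2 * (2 / (1 - x) ^+ 2)) <= a * (1 + h) ^+ 2.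
  have -> : d%:R * (lam * delta ^+ 2 * (2 / (1 - x) ^+ 2)) =
      2 * lam * d%:R * (delta / (1 - x)) ^+ 2.
    by field; rewrite subr_eq0 gt_eqF.
  have -> : a * (1 + h) ^+ 2 = 2 * lam * d%:R * ((1 + h) / rho) ^+ 2.
    by rewrite /a; field; rewrite gt_eqF.
  apply: ler_wpM2l; first by rewrite !mulr_ge0// ltW.
  rewrite lerXn2r ?nnegrE// ?divr_ge0 ?subr_ge0 ?(ltW x1) ?(ltW d0) ?(ltW r0)//.
    exact: ltW a1.
  by rewrite addr_ge0// ltW.
have fin : a * (1 + h) ^+ 2 + (1 - a) / 4 < 1.
  by apply: quadratic_slack; rewrite ?a0 ?a1.
apply: (le_lt_trans (ler_wpM2l (ler0n _ d) sum_le)); rewrite mulrDr.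
exact: le_lt_trans (lerD main hM) fin.
Qed.

(** * Choice of the grid: lower bound *)

(** From [(1 - u) ^+ d * (1 + u) ^+ d <= 1] and Bernoulli's inequality. Unlike a
    second-order expansion, this has the right order both for small and for large
    [d * u]. *)
Lemma bernoulli_survival (R : realFieldType) (u : R) d : 0 <= u <= 1 ->
  d%:R * u / (1 + d%:R * u) <= 1 - (1 - u) ^+ d.
Proof.
move=> /andP[u0 u1]; have du0 : 0 <= d%:R * u by rewrite mulr_ge0.
have bern : 1 + d%:R * u <= (1 + u) ^+ d.
  elim: d {du0} => [|d IH]; first by rewrite mul0r addr0 expr0.
  have d0 : 0 <= d%:R * u * u by rewrite !mulr_ge0.
  rewrite exprS; apply: le_trans (ler_wpM2l _ IH); last by lra.
  by rewrite -natr1 mulrDl mul1r mulrDl mulrDr mulrDr; lra.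
rewrite ler_pdivrMr; last by lra.
have prod1 : (1 - u) ^+ d * (1 + d%:R * u) <= 1.
  apply: le_trans (ler_wpM2l _ bern) _; first by rewrite exprn_ge0//; lra.
  rewrite -exprMn exprn_ile1//; first by nra.
  by have := mulr_ge0 u0 u0; lra.
by rewrite mulrBl mul1r; lra.
Qed.

(** The square sum counts each off-diagonal product [x ^+ i * x ^+ a] twice. *)
Lemma triangle_sum_ge (R : realFieldType) (x : R) e J : 0 <= x -> (e <= J)%N ->
  (\sum_(e <= i < J) x ^+ i) ^+ 2 <=
  2 * \sum_(a < J) x ^+ a * \sum_(e <= i < a.+1) x ^+ i.
Proof.
move=> x0; elim: J => [|J IH].
  by rewrite leqn0 => /eqP->; rewrite big_geq// big_ord0 mulr0 expr0n.
rewrite leq_eqVlt => /predU1P[->|eJ].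
  rewrite big_geq// expr0n mulr_ge0// sumr_ge0// => a _.
  by rewrite mulr_ge0 ?exprn_ge0// sumr_ge0// => i _; rewrite exprn_ge0.
rewrite ltnS in eJ; rewrite big_ord_recr /= !(big_nat_recr J)//=.
have := IH eJ; have := sqr_ge0 (x ^+ J).
set U := \sum_(e <= i < J) _; set W := \sum_(a < J) _; set y := x ^+ J.
by move=> h1 h2; rewrite (_ : (U + y) ^+ 2 = U ^+ 2 + 2 * (y * U) + y ^+ 2); [rewrite mulrDr; lra|ring].
Qed.

Lemma mass_ge (R : realType) (r delta : R) M m (k : 'I_M.+1) :
  0 < r -> 0 < delta -> (k < M)%N -> (k < m)%N ->
  r * delta * expR (- (r * delta)) ^+ m <= mass delta r k.
Proof.
move=> r0 d0 kM km; rewrite /mass kM; set x := expR _.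
have rd : 0 < r * delta by rewrite mulr_gt0.
have x0 : 0 <= x by exact: expR_ge0.
have x1 : x <= 1 by rewrite /x expR_le1 oppr_le0 ltW.
have step : r * delta * x <= 1 - x.
  have := expRN_le (ltW rd); rewrite -/x -[leRHS]mul1r ler_pdivlMr; last by lra.
  by rewrite mulrDr mulr1 mulrC; lra.
rewrite exprS -[X in X - _]mul1r -mulrBl.
apply: le_trans (ler_wpM2r (exprn_ge0 k x0) step).
rewrite -[leRHS]mulrA -exprS; apply: ler_wpM2l; first exact: ltW.
exact: ler_wiXn2l.
Qed.

(** For [x = exp (- y)] with [y] small, the double sum times [y ^ 2] approximates
    the integral of [exp (- t - u)] over [0 < u < t], which is [1 / 2]: the
    constant in the mean offspring [d * lam / (2 * rho ^ 2)]. The powers [x ^+ e]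
    and [x ^+ J] are boundary terms. *)
Lemma geometric_triangle_ge (R : realFieldType) (x y : R) e J :
  0 <= x < 1 -> 1 - x <= y -> (e <= J)%N ->
  (x ^+ e - x ^+ J) ^+ 2 / (2 * y ^+ 2) <=
  \sum_(a < J) x ^+ a * \sum_(e <= i < a.+1) x ^+ i.
Proof.
move=> /andP[x0 x1] xy eJ; have y0 : 0 < y by lra.
set W := \sum_(a < J) _; rewrite ler_pdivrMr ?mulr_gt0 ?exprn_gt0//.
have := triangle_sum_ge x0 eJ; rewrite -/W; set U := \sum_(e <= i < J) _ => UW.
have U0 : 0 <= U by apply: sumr_ge0 => i _; rewrite exprn_ge0.
have Ux : U * (1 - x) = x ^+ e - x ^+ J.
  rewrite /U big_distrl /= (telescope_sumr_eq (fun k => - x ^+ k))//.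
    by rewrite opprK addrC.
  by move=> k _; rewrite exprS; ring.
rewrite -Ux exprMn [W * _]mulrCA mulrA; apply: ler_pM; rewrite ?exprn_ge0//; first by lra.
by apply: lerXn2r; rewrite ?nnegrE; lra.
Qed.

(** The hypothesis of [survival_lb] holds for truncated geometric labels. Here
    [J * delta] is the time window in which everything takes place, [eta] bounds
    the relative errors (the window against the rates 1 and [lam], the slack [e],
    the end of the window), and the mean offspring
    [d * lam / (2 * rho ^ 2)] exceeds 1 by [kappa] after these errors. This surplus
    pays for the nonlinearity in [q], which is bounded by [kappa] as well. *)
Lemma survival_step (R : realType) (lam rho delta q eta kappa : R) (d e J M : nat) :
  0 < lam -> 0 < rho -> 0 < delta -> (J <= M)%N -> (e <= J)%N -> (0 < d)%N ->
  0 <= q -> 0 <= eta -> 2 * eta <= 1 ->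
  (1 + 2 * lam) * (J%:R * delta) <= eta -> rho * delta * e%:R <= eta ->
  expR (- (rho * delta)) ^+ J <= eta ->
  q * (d%:R * lam * (J%:R * delta)) <= kappa -> kappa <= 1 ->
  1 + kappa <= d%:R * lam / (2 * rho ^+ 2) * ((1 - eta) ^+ 2 * (1 - 2 * eta) ^+ 2) ->
  q <= \sum_(a < M.+1 | (a < J)%N) mass delta 1 a * expR (- (rho * delta)) ^+ (a + e) *
    (1 - (1 - q * (lam * delta * expR (- (lam * delta)) ^+ (2 * J)) *
       \sum_(e <= i < a.+1) expR (- (rho * delta)) ^+ i) ^+ d).
Proof.
move=> l0 r0 d0 JM eJ dpos q0 eta0 eta1 heps he hJ hk k1 main.
set x := expR (- (rho * delta)) in hJ *.
set sigma := lam * delta * _; pose E1 := expR (- (1 * delta)) ^+ J.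
have rd0 : 0 < rho * delta by rewrite mulr_gt0.
have x0 : 0 <= x by exact: expR_ge0.
have x1 : x < 1 by rewrite /x expR_lt1 oppr_lt0.
have y1 : 1 - x <= rho * delta by have := expR_ge1Dx (- (rho * delta)); rewrite -/x; lra.
have E10 : 0 <= E1 by rewrite exprn_ge0 ?expR_ge0.
have s0 : 0 <= sigma by rewrite !mulr_ge0 ?exprn_ge0 ?expR_ge0// ltW.
have sl : sigma <= lam * delta.
  rewrite /sigma ler_piMr ?exprn_ile1 ?expR_ge0 ?expR_le1 ?oppr_le0//;
  by rewrite mulr_ge0// ltW.
have kap0 : 0 <= kappa by apply: le_trans hk; rewrite !mulr_ge0// ltW.
pose S (a : nat) := \sum_(e <= i < a.+1) x ^+ i.
have S0 a : 0 <= S a by apply: sumr_ge0 => i _; rewrite exprn_ge0.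
have SJ a : (a < J)%N -> S a <= J%:R.
  move=> aJ; apply: (@le_trans _ _ (\sum_(e <= i < a.+1) 1)).
    by apply: ler_sum => i _; rewrite exprn_ile1// ltW.
  by rewrite sumr_const_nat ler_nat (leq_trans (leq_subr _ _)).
pose K := delta * E1 * x ^+ e * (d%:R * sigma) / (1 + kappa).
(* Bernoulli's inequality linearizes each term, at the price of the common
   factor [1 + kappa]. *)
have term (a : 'I_M.+1) : (a < J)%N -> q * K * (x ^+ a * S a) <=
    mass delta 1 a * x ^+ (a + e) * (1 - (1 - q * sigma * S a) ^+ d).
  move=> aJ; set u := q * sigma * S a.
  have u0 : 0 <= u by exact: mulr_ge0 (mulr_ge0 q0 s0) (S0 a).
  have du : d%:R * u <= kappa.
    apply: le_trans hk; rewrite (_ : d%:R * u = q * (d%:R * (sigma * S a))); last first.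
      by rewrite /u; ring.
    rewrite (_ : d%:R * lam * _ = d%:R * (lam * delta * J%:R)); last by ring.
    by do 2 apply: ler_wpM2l => //; apply: ler_pM => //; exact: SJ.
  have u1 : u <= 1.
    apply: le_trans (le_trans du k1); rewrite ler_peMl// ler1n//.
  have b := bernoulli_survival d (introT andP (conj u0 u1)).
  have b' : d%:R * u / (1 + kappa) <= 1 - (1 - u) ^+ d.
    apply: le_trans b; apply: ler_wpM2l; first by rewrite mulr_ge0.
    by rewrite lef_pV2 ?posrE; have := mulr_ge0 (ler0n R d) u0; lra.
  have -> : q * K * (x ^+ a * S a) =
      delta * E1 * x ^+ (a + e) * (d%:R * u / (1 + kappa)).
    by rewrite /K /u exprD; field; lra.
  apply: ler_pM => //.
  - by rewrite !mulr_ge0 ?exprn_ge0// ltW.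
  - by rewrite divr_ge0 ?mulr_ge0//; lra.
  apply: ler_wpM2r; first by rewrite exprn_ge0.
  by rewrite -[X in X * E1]mul1r; apply: mass_ge => //; exact: leq_trans JM.
apply: (@le_trans _ _ (\sum_(a < M.+1 | (a < J)%N) q * K * (x ^+ a * S a))); last first.
  exact: ler_sum.
rewrite -(big_ord_widen M.+1 (fun a => q * K * (x ^+ a * S a))) ?leqW// -big_distrr /=.
rewrite -mulrA -[leLHS]mulr1; apply: ler_wpM2l => //.
have W := geometric_triangle_ge (introT andP (conj x0 x1)) y1 eJ.
apply: le_trans (ler_wpM2l _ W); last first.
  by rewrite /K !mulr_ge0 ?exprn_ge0 ?invr_ge0 ?(ltW d0)//; lra.
rewrite /K mulrAC ler_pdivlMr ?mul1r; last by lra.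
apply: (le_trans main).
pose E2 := expR (- (lam * delta)) ^+ (2 * J).
have -> : delta * E1 * x ^+ e * (d%:R * sigma) *
    ((x ^+ e - x ^+ J) ^+ 2 / (2 * (rho * delta) ^+ 2)) =
    d%:R * lam / (2 * rho ^+ 2) * (E1 * E2 * x ^+ e * (x ^+ e - x ^+ J) ^+ 2).
  by rewrite /sigma -/E2; field; rewrite !gt_eqF.
apply: ler_wpM2l; first by rewrite divr_ge0 ?mulr_ge0 ?exprn_ge0// ltW.
have hE : 1 - eta <= E1 * E2.
  rewrite /E1 /E2 -!expRM_natl -expRD; apply: le_trans (expR_ge1Dx _).
  rewrite natrM; move: heps; set w := J%:R * delta.
  rewrite (_ : J%:R * - (1 * delta) + 2 * J%:R * - (lam * delta) = - ((1 + 2 * lam) * w)).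
    by lra.
  by rewrite /w; ring.
have hxe : 1 - eta <= x ^+ e.
  rewrite /x -expRM_natl; apply: le_trans (expR_ge1Dx _).
  by move: he; rewrite mulrC mulrN; lra.
rewrite (_ : (1 - eta) ^+ 2 * _ = (1 - eta) * (1 - eta) * (1 - 2 * eta) ^+ 2); last by ring.
have e1 : 0 <= 1 - eta by lra.
apply: ler_pM; [exact: mulr_ge0|by rewrite exprn_ge0; lra|exact: ler_pM|].
by apply: lerXn2r; rewrite ?nnegrE; lra.
Qed.

(** The bound [q] depends on [d] but not on the slack [e], hence not on the number
    of generations. The window [ep] is long, [eta^-1] units, on the time scale
    [1 / (c * sqrt d)] of deaths, but short on the scale of the spread and chase
    clocks when [d] is large; the number [J] of meshes is chosen after [e]. A death
    rate smaller than [c * sqrt d] only enters through the law of the death clocks,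
    and makes survival easier. *)
Lemma survival_bounded_below (R : realType) (lam c : R) :
  0 < lam -> 0 < c -> 2 * c ^+ 2 < lam ->
  exists d0 : nat, forall d, (0 < d)%N -> (d0 <= d)%N ->
  exists2 q : R, 0 < q & forall rho e, 0 < rho < c * Num.sqrt d%:R ->
  exists delta M, 0 < delta /\ forall k,
    q <= @survival d M e R (fun a => @mass R delta M (key_rate lam rho a)) k 0.
Proof.
move=> l0 c0 cl.
have c20 : 0 < 2 * c ^+ 2 by rewrite mulr_gt0// exprn_gt0.
pose L := lam / (2 * c ^+ 2).
have L1 : 1 < L by rewrite /L ltr_pdivlMr// mul1r.
pose eta := (1 - L^-1) / 12.
have L0 : 0 < L by lra.
have iL : L^-1 < 1 by rewrite invf_lt1.
have eta0 : 0 < eta by rewrite divr_gt0// subr_gt0.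
have eta1 : 6 * eta <= 1 by have := invr_gt0 L; rewrite L0 /eta; lra.
pose kappa := Num.min 1 ((L - 1) / 2).
have kap0 : 0 < kappa by rewrite lt_min ltr01 /= divr_gt0// subr_gt0.
have kap1 : kappa <= 1 by rewrite ge_min lexx.
have main : 1 + kappa <= L * ((1 - eta) ^+ 2 * (1 - 2 * eta) ^+ 2).
  have k2 : kappa <= (L - 1) / 2 by rewrite ge_min lexx orbT.
  have Leta : L * eta = (L - 1) / 12 by rewrite /eta; field; rewrite gt_eqF.
  have : 1 - 6 * eta <= (1 - eta) ^+ 2 * (1 - 2 * eta) ^+ 2.
    have e2 := mulr_ge0 (ltW eta0) (ltW eta0).
    rewrite -subr_ge0 (_ : _ - _ = eta * eta * (13 - 12 * eta + 4 * (eta * eta))); last by ring.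
    by rewrite mulr_ge0//; lra.
  move=> /(ler_wpM2l (ltW L0)); apply: le_trans; rewrite mulrBr mulr1 mulrCA Leta; lra.
clearbody eta kappa.
pose B := (1 + 2 * lam) * eta^-1 / (c * eta).
have B0 : 0 <= B by rewrite !mulr_ge0 ?invr_ge0 ?mulr_ge0 ?(ltW eta0) ?(ltW c0)//; lra.
exists (Num.truncn (B ^+ 2)).+1 => d dpos d0d.
have dR : 0 < d%:R :> R by rewrite ltr0n.
pose s := Num.sqrt d%:R : R.
have s0 : 0 < s by rewrite sqrtr_gt0.
have ss : s ^+ 2 = d%:R by rewrite sqr_sqrtr// ltW.
have Bs : B <= s.
  rewrite -(ler_pXn2r (n := 2))// ?nnegrE ?(ltW s0)// ss.
  by apply/ltW/(lt_le_trans (truncnS_gt _)); rewrite ler_nat.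
pose rho' := c * s; have r0 : 0 < rho' by rewrite mulr_gt0.
pose ep := eta^-1 / rho'.
have ep0 : 0 < ep by rewrite divr_gt0// invr_gt0.
pose K := d%:R * lam * ep; have K0 : 0 < K by exact: mulr_gt0 (mulr_gt0 dR l0) ep0.
have kK : 0 < kappa + K by rewrite addr_gt0.
exists (kappa / (kappa + K)); first by rewrite divr_gt0.
move=> rho e /andP[rho0 rhor].
pose J := ((Num.truncn (eta^-1 * e%:R / eta)).+1 + e)%N.
have J0 : 0 < J%:R :> R by rewrite ltr0n.
pose delta := ep / J%:R; have d0 : 0 < delta by rewrite divr_gt0.
have Jd : J%:R * delta = ep by rewrite /delta mulrC divfK// gt_eqF.
have rep : rho' * ep = eta^-1 by rewrite /ep mulrC divfK// gt_eqF.
exists delta, (2 * J + e)%N; split=> // k.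
have x0 : 0 <= expR (- (rho' * delta)) by exact: expR_ge0.
have x1 : expR (- (rho' * delta)) <= 1 by rewrite expR_le1 oppr_le0 ltW// mulr_gt0.
rewrite -[leLHS]mulr1 -(expr0 (expR (- (rho' * delta)))).
apply: (@survival_lb _ _ _ _ _ _ _ J _ _
  (lam * delta * expR (- (lam * delta)) ^+ (2 * J))) => //.
- by move=> a; exact: sum_mass.
- by move=> a b; apply: mass_ge0 => //; rewrite ltW// key_rate_gt0.
- by rewrite x0.
- by rewrite divr_ge0 ?(ltW kap0) ?(ltW kK)//= ler_pdivrMr// mul1r lerDl ltW.
- exact: mulr_ge0 (mulr_ge0 (ltW l0) (ltW d0)) (exprn_ge0 _ (expR_ge0 _)).
- move=> m mM; rewrite /key_rate kdeathNchase eqxx sum_mass_ge//.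
  apply: lerXn2r; rewrite ?nnegrE ?expR_ge0// ler_expR lerN2.
  by rewrite ler_pM2r// ltW.
- move=> a aJ; rewrite /key_rate kspreadNchase kspreadNdeath.
  by apply: mass_ge => //; apply: (leq_trans aJ); exact: leq_addr.
rewrite /key_rate eqxx.
apply: (survival_step (eta := eta) (kappa := kappa)) => //.
- by rewrite (leq_trans _ (leq_addr _ _))// leq_pmull.
- exact: leq_addl.
- by rewrite divr_ge0 ?(ltW kap0) ?(ltW kK).
- exact: ltW.
- lra.
- rewrite Jd /ep mulrA ler_pdivrMr//.
  have := Bs; rewrite /B ler_pdivrMr ?mulr_gt0// /rho'.
  by rewrite (_ : s * (c * eta) = eta * (c * s)); last by ring.
- rewrite /delta mulrA rep mulrAC ler_pdivrMr// [eta * _]mulrC -ler_pdivrMr//.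
  by apply/ltW/(lt_le_trans (truncnS_gt _)); rewrite ler_nat leq_addr.
- rewrite -expRM_natl mulrN mulrCA Jd rep.
  apply: le_trans (expRN_le _) _; first by rewrite invr_ge0 ltW.
  rewrite -[leRHS]invrK lef_pV2 ?posrE ?invr_gt0//; first by rewrite lerDr.
  by rewrite addr_gt0// invr_gt0.
- rewrite Jd -/K mulrAC ler_pdivrMr//; apply: ler_wpM2l; first exact: ltW.
  by rewrite lerDr ltW.
- rewrite (_ : d%:R * lam / _ = L)// /L /rho' exprMn ss.
  by field; rewrite !gt_eqF.
Qed.

(** * The critical death rate *)

Theorem theorem3 (R : realType) (lam c C : R) :
  0 < lam -> c < Num.sqrt (lam / 2) -> Num.sqrt (2 * lam) < C ->
  exists d0 : nat, forall d : nat, (2 <= d)%N -> (d0 <= d)%N ->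
  forall (disp : R -> measure_display)
    (Omega : forall rho : R, measurableType (disp rho))
    (P : forall rho : R, probability (Omega rho) R)
    (X : forall rho : R, R -> Omega rho -> vertex d -> state),
  (forall rho : R, 0 < rho ->
     is_CED (@tree_adj d) lam rho (@tree_init d) (P rho) (X rho)) ->
  ((c * Num.sqrt d%:R)%:E <= rho_c P X)%E /\
  (rho_c P X <= (C * Num.sqrt d%:R)%:E)%E.
Proof.
move=> l0 cl lC.
have C0 : 0 < C by apply: le_lt_trans lC; exact: sqrtr_ge0.
have lC2 : 2 * lam < C ^+ 2.
  have l2 : 0 <= 2 * lam by rewrite mulr_ge0// ltW.
  rewrite -(sqr_sqrtr l2) ltr_pXn2r// nnegrE ?sqrtr_ge0//; exact: ltW.
have [d0 lower] : exists d0 : nat, forall d, (0 < d)%N -> (d0 <= d)%N ->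
    0 < c -> exists2 q : R, 0 < q & forall rho e, 0 < rho < c * Num.sqrt d%:R ->
    exists delta M, 0 < delta /\ forall k,
    q <= @survival d M e R (fun a => @mass R delta M (key_rate lam rho a)) k 0.
  have [c0|c0] := leP c 0.
    by exists 0%N.
  have cl2 : 2 * c ^+ 2 < lam.
    have l2 : 0 <= lam / 2 by rewrite divr_ge0// ltW.
    have : c ^+ 2 < lam / 2.
      by rewrite -(sqr_sqrtr l2) ltr_pXn2r// nnegrE ?sqrtr_ge0// ltW.
    by rewrite ltr_pdivlMr// mulrC.
  have [d0 H] := survival_bounded_below l0 c0 cl2.
  by exists d0 => d dp dd _; exact: H.
exists d0 => d d2 d0d disp Omega P X ced.
have dpos : (0 < d)%N by apply: leq_trans d2.
have s0 : 0 < Num.sqrt d%:R :> R by rewrite sqrtr_gt0 ltr0n.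
split.
- apply: le_ereal_inf_tmp => _ [rho [rho0 PB] <-]; rewrite lee_fin leNgt.
  apply/negP => rhoc.
  have c0 : 0 < c by have := lt_trans rho0 rhoc; rewrite pmulr_lgt0.
  have [q q0 H] := lower d dpos d0d c0.
  have [mX rcX [clock [ind law drvX]]] := ced rho rho0.
  suff : q <= pr (P rho) (infinitely_many_blue (X rho)).
    by rewrite /pr PB /= leNgt q0.
  apply: (pr_infinitely_many_blue_ge mX rcX) => n.
  have [delta [M [delta0 hq]]] := H rho n.+2 (introT andP (conj rho0 rhoc)).
  apply: le_trans (hq n.+1) _.
  exact: (pr_blue_beyond_ge l0 rho0 mX rcX ind law drvX).
- apply: ereal_inf_lbound; exists (C * Num.sqrt d%:R) => //.
  set rho := C * _; have rho0 : 0 < rho by rewrite mulr_gt0.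
  have [mX rcX [clock [ind law drvX]]] := ced rho rho0.
  split => //; rewrite (infinitely_many_blueE (X rho)).
  have mB := measurable_blue_beyond mX rcX.
  have mI : measurable (\bigcap_n blue_beyond (X rho) n) by exact: bigcapT_measurable.
  rewrite prE//; congr EFin.
  have dl : 2 * lam * d%:R < rho ^+ 2.
    by rewrite exprMn sqr_sqrtr// ltr_pM2r// ltr0n.
  have [delta [M [delta0 small]]] := exists_level_bound l0 rho0 dl.
  apply: (pr_geo_eq0 (a := d%:R * \sum_k level_bound lam rho delta (M := M) k)).
    rewrite small andbT mulr_ge0// sumr_ge0// => k _.
    rewrite mulr_ge0 ?mass_ge0 ?(ltW rho0)//.
    by case: ifP => // _; rewrite mulr_ge0 ?exprn_ge0 ?mulr_ge0// ltW.
  move=> n; apply: le_trans (pr_blue_beyond_le l0 rho0 mX rcX ind law drvX M delta0 n).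
  by apply: pr_mono => //; exact: bigcap_inf.
Qed.
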